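(* (Weak associativity) Let $(V,Y,e^{\mathbf z\cdot\mathbf T},|0\rangle)$ be an $(n,N)$-cohomological vertex algebra over a commutative ring $R$. For all $a,c\in V$ and all $b\in V$, the series $$C(\mathbf z,\mathbf w)=Y(a,\mathbf z-\mathbf w)Y(b,-\mathbf w)c-Y(Y(a,\mathbf z)b,-\mathbf w)c$$ is local for the pair of variables $(\mathbf z,\mathbf w)$, with the number of terms in the local expansion uniformly bounded for all $b\in V$ (that is, for given $a,c$ the bound $\mathbf K$ in the definition of locality can be chosen independently of $b$).
   Context: Fix a commutative ring $R$ and integers $N,n$ with $n\ge1$; $\mathbb N=\{0,1,2,\dots\}$. Bold letters are $n$-tuples: variables $\mathbf z=(z_1,\dots,z_n)$, multi-indices in $\mathbb N^n$; $\mathbf 0,\mathbf 1$ are constant tuples; $\mathbf k\ge\mathbf j$ is componentwise; $|\mathbf k|=\sum k_i$; $\mathbf z^{\mathbf k}=\prod z_i^{k_i}$; $\binom{\mathbf k}{\mathbf j}=\prod\binom{k_i}{j_i}$. For a $\mathbb Z$-graded $R$-module, $p(a)$ is the degree of a homogeneous element and $p(a,b)=(-1)^{p(a)p(b)}$. Formal calculus. $\mathcal K^{\mathbf z}_{\mathrm{dist}}(V)$ is the graded $R$-module of series $A(\mathbf z)=\sum_{\mathbf k\ge\mathbf 0}(\mathbf z^{\mathbf k}A_{-\mathbf 1-\mathbf k}+\Omega^{\mathbf k}_{\mathbf z}A_{\mathbf k})$ with coefficients in $V$, where the $z_i$ have degree $0$ and the symbols $\Omega_{\mathbf z}^{\mathbf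 k}$ have degree $N$; $V\langle\!\langle\mathbf z\rangle\!\rangle$ is the submodule of series for which there is $\mathbf K$ with $A_{\mathbf k}=0$ unless $\mathbf k\le\mathbf K$. $\mathcal K^{\mathbf z,\mathbf w}_{\mathrm{dist}}(V)$ consists of all formal series in $\mathbf z^{\mathbf j}\mathbf w^{\mathbf k}$, $\mathbf z^{\mathbf j}\Omega^{\mathbf k}_{\mathbf w}$, $\mathbf w^{\mathbf j}\Omega^{\mathbf k}_{\mathbf z}$, $\Omega^{\mathbf j}_{\mathbf z}\Omega^{\mathbf k}_{\mathbf w}$. Products (when no infinite sums of coefficients occur) are given by $\mathbf z^{\mathbf j}\Omega^{\mathbf k}_{\mathbf z}=\Omega^{\mathbf k-\mathbf j}_{\mathbf z}$ if $\mathbf k\ge\mathbf j$ and $0$ otherwise, $\Omega^{\mathbf j}_{\mathbf z}\Omega^{\mathbf k}_{\mathbf z}=0$, $\Omega^{\mathbf j}_{\mathbf z}\Omega^{\mathbf k}_{\mathbf w}=(-1)^N\Omega^{\mathbf k}_{\mathbf w}\Omega^{\mathbf j}_{\mathbf z}$, variables commute with everything, and a homogeneous coefficient $a$ satisfies $a\Omega=(-1)^{p(a)N}\Omega a$. Hasse derivatives: $\partial^{(\mathbf j)}_{\mathbf z}\mathbf z^{\mathbf k}=\binom{\mathbf k}{\mathbf j}\mathbf z^{\mathbf k-\mathbf j}$, $\partial^{(\mathbf j)}_{\mathbf z}\Omega^{\mathbf k}_{\mathbf z}=(-1)^{|\mathbf j|}\binom{\mathbf k+\mathbf j}{\mathbf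 j}\Omega^{\mathbf k+\mathbf j}_{\mathbf z}$; in a product $\partial^{(\mathbf k)}FG$ the derivative acts on $F$ only. Residue: $\operatorname{Res}_{\mathbf z}(\mathbf z^{\mathbf j}f(\mathbf w))=0$, $\operatorname{Res}_{\mathbf z}(\Omega^{\mathbf j}_{\mathbf z}f(\mathbf w))=\delta_{\mathbf j,\mathbf 0}f(\mathbf w)$. $\Delta(\mathbf z,\mathbf w)=\sum_{\mathbf j\ge\mathbf 0}\big(\mathbf w^{\mathbf j}\Omega^{\mathbf j}_{\mathbf z}+(-1)^N\mathbf z^{\mathbf j}\Omega^{\mathbf j}_{\mathbf w}\big)$. Convention: $\Omega^{\mathbf m}_{-\mathbf w}=(-1)^{|\mathbf m|+N+1}\Omega^{\mathbf m}_{\mathbf w}$; for a series $A$, $A(-\mathbf w)$ is obtained by replacing $\mathbf w^{\mathbf k}$ by $(-1)^{|\mathbf k|}\mathbf w^{\mathbf k}$ and $\Omega^{\mathbf k}_{\mathbf w}$ by $\Omega^{\mathbf k}_{-\mathbf w}$. Fields. A cohomological field on $V$ is $A(\mathbf z)=\sum_{\mathbf j}(\mathbf z^{\mathbf j}A_{(-\mathbf 1-\mathbf j)}+\Omega^{\mathbf j}_{\mathbf z}A_{(\mathbf j)})\in\mathcal K^{\mathbf z}_{\mathrm{dist}}(\operatorname{End}V)$ with $A(\mathbf z)v\in V\langle\!\langle\mathbf z\rangle\!\rangle$ for all $v$; it is homogeneous of degree $p(A)$ if each $A_{(-\mathbf 1-\mathbf j)}$ has degree $p(A)$ and each $A_{(\mathbf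 j)}$ has degree $p(A)-N$. $[A(\mathbf z),B(\mathbf w)]=A(\mathbf z)B(\mathbf w)-p(A,B)B(\mathbf w)A(\mathbf z)$. A series $f(\mathbf z,\mathbf w)$ is local (with respect to $(\mathbf z,\mathbf w)$) if $f=\sum_{\mathbf 0\le\mathbf j\le\mathbf K}\partial^{(\mathbf j)}_{\mathbf w}\Delta(\mathbf z,\mathbf w)g^{\mathbf j}(\mathbf w)$ for some $\mathbf K\in\mathbb N^n$, with $g^{\mathbf j}(\mathbf w)=\operatorname{Res}_{\mathbf z}((\mathbf z-\mathbf w)^{\mathbf j}f)$. Fields $A,B$ are mutually local if $[A(\mathbf z),B(\mathbf w)]\in\mathcal K^{\mathbf z,\mathbf w}_{\mathrm{dist}}(\operatorname{End}V)$ is local. An $(n,N)$-cohomological vertex algebra (CVA) $(V,Y,e^{\mathbf z\cdot\mathbf T},|0\rangle)$ over $R$ consists of a $\mathbb Z$-graded $R$-module $V$; a degree $0$ $R$-linear map $Y$, $a\mapsto Y(a,\mathbf z)=\sum_{\mathbf j}(\mathbf z^{\mathbf j}a_{(-\mathbf 1-\mathbf j)}+\Omega^{\mathbf j}_{\mathbf z}a_{(\mathbf j)})\in\mathcal K^{\mathbf z}_{\mathrm{dist}}(\operatorname{End}V)$ (for homogeneous $a$, $a_{(-\mathbf 1-\mathbf j)}$ has degree $p(a)$ and $a_{(\mathbf j)}$ degree $p(a)-N$); degree $0$ endomorphisms $T^{(\mathbf j)}$, $\mathbf j\ge\mathbf 0$, with $T^{(\mathbf 0)}=\mathrm{id}_V$,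 assembled as $e^{\mathbf z\cdot\mathbf T}=\sum_{\mathbf j}\mathbf z^{\mathbf j}T^{(\mathbf j)}$; and a vacuum $|0\rangle\in V^0$; such that for all $a,b\in V$: (V1) $Y(a,\mathbf z)b\in V\langle\!\langle\mathbf z\rangle\!\rangle$; (V2) $Y(|0\rangle,\mathbf z)=\mathrm{id}_V$; (V3) $Y(a,\mathbf z)|0\rangle=e^{\mathbf z\cdot\mathbf T}a$; (V4) $e^{\mathbf w\cdot\mathbf T}Y(a,\mathbf z)e^{-\mathbf w\cdot\mathbf T}=Y(a,\mathbf z+\mathbf w):=\sum_{\mathbf k}\mathbf w^{\mathbf k}\partial^{(\mathbf k)}_{\mathbf z}Y(a,\mathbf z)$; (V5) for homogeneous $a,b$, $Y(a,\mathbf z)$ and $Y(b,\mathbf w)$ are mutually local. Further notation: $Y(a,\mathbf z-\mathbf w)=\sum_{\mathbf k}(-1)^{|\mathbf k|}\mathbf w^{\mathbf k}\partial^{(\mathbf k)}_{\mathbf z}Y(a,\mathbf z)$, and $Y(Y(a,\mathbf z)b,\mathbf w)=\sum_{\mathbf k\ge\mathbf 0}\big(\mathbf z^{\mathbf k}Y(a_{(-\mathbf 1-\mathbf k)}b,\mathbf w)+\Omega^{\mathbf k}_{\mathbf z}Y(a_{(\mathbf k)}b,\mathbf w)\big)$. *)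

(* Defs.v *)
(* 'X_{1..n} is the type of multi-indices in N^n, with the componentwise order
   (_ <= _)%MM and mdeg k = |k|; \sum_(i \in A) F i is a sum over a classical
   set, equal to 0 when infinitely many F i are nonzero. *)
From mathcomp Require Import all_boot all_order all_algebra.
From mathcomp Require Import boolp classical_sets functions cardinality fsbigop.
From mathcomp Require Import mpoly.

Set Implicit Arguments.
Unset Strict Implicit.
Unset Printing Implicit Defensive.

Import GRing.Theory.
Local Open Scope ring_scope.
Local Open Scope classical_set_scope.

(* A Z-grading V = \bigoplus_i V^i is given by its projections onto the
   homogeneous components: V^i is the image of gcomp i. *)
Record gradedModule (R : comPzRingType) := GradedModule {
  gm_sort :> lmodType R;
  gcomp : int -> {linear gm_sort -> gm_sort};
  gcompK : forall i j v,
    gcomp i (gcomp j v) = if i == j then gcomp j v else 0;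
  gcomp_finite : forall v, finite_set [set i | gcomp i v != 0];
  gcomp_sum : forall v, v = \sum_(i \in [set: int]) gcomp i v
}.

Definition in_degree (R : comPzRingType) (V : gradedModule R) (i : int) (v : V) :=
  gcomp V i v = v.

Definition has_degree (R : comPzRingType) (V : gradedModule R) (d : int)
    (phi : V -> V) :=
  forall i v, in_degree i v -> in_degree (i + d) (phi v).

Definition mbin (n : nat) (k j : 'X_{1..n}) : nat :=
  (\prod_(i < n) 'C(k i, j i))%N.

(* Pow k stands for z^k, Om k for Omega_z^k. *)
Inductive symb (n : nat) := Pow of 'X_{1..n} | Om of 'X_{1..n}.

(* A(z) = \sum_k (z^k A (Pow k) + Omega_z^k A (Om k)); the coefficients stand
   to the right of the symbols, so A (Pow k) is A_{-1-k} and A (Om k) is A_k.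
   Any family of coefficients is
   allowed. *)
Definition kdist (n : nat) (M : Type) := symb n -> M.

(* Two variables: the coefficient F s t belongs to s(z) t(w), in that order;
   thus F is a series in z whose coefficients are series in w, and an operation
   on w-series acts on F by fun s => _ (F s). *)
Definition kdist2 (n : nat) (M : Type) := kdist n (kdist n M).

(* The submodule V<<z>>. *)
Definition laurent (n : nat) (M : zmodType) (A : kdist n M) :=
  exists K : 'X_{1..n}, forall k, ~~ (k <= K)%MM -> A (Om k) = 0.

Definition kconst (n : nat) (M : zmodType) (x : M) : kdist n M :=
  fun s => if s is Pow k then if k == 0%MM then x else 0 else 0.

(* Multiplication by z^j. *)
Definition mulmon (n : nat) (M : zmodType) (j : 'X_{1..n}) (A : kdist n M) :
    kdist n M :=
  fun s => match s with
  | Pow k => if (j <= k)%MM then A (Pow (k - j)%MM) else 0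
  | Om k => A (Om (k + j)%MM)
  end.

(* The Hasse derivative of order j, read off coefficientwise: z^k comes from
   z^(k + j) and Omega^k from Omega^(k - j). *)
Definition hasse (n : nat) (M : zmodType) (j : 'X_{1..n}) (A : kdist n M) :
    kdist n M :=
  fun s => match s with
  | Pow k => A (Pow (k + j)%MM) *+ mbin (k + j)%MM j
  | Om k => if (j <= k)%MM
            then A (Om (k - j)%MM) *~ ((-1) ^+ mdeg j * (mbin k j)%:Z) else 0
  end.

(* A(-w), with Omega_{-w}^k = (-1)^(|k| + N + 1) Omega_w^k. *)
Definition kneg (n : nat) (N : int) (M : zmodType) (A : kdist n M) :
    kdist n M :=
  fun s => match s with
  | Pow k => A (Pow k) *~ (-1) ^+ mdeg k
  | Om k => A (Om k) *~ (-1) ^ ((mdeg k)%:Z + N + 1)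
  end.

Definition resz (n : nat) (M : Type) (F : kdist2 n M) : kdist n M :=
  F (Om 0%MM).

(* Product of two series in the same variable, for a bilinear pairing op of
   coefficients; opO is op preceded by the Koszul sign for moving the left
   coefficient past an Omega.  The sums over all multi-indices are meant when
   they have finite support, i.e. when the product is defined. *)
Definition kmul (n : nat) (A B : Type) (C : zmodType) (op opO : A -> B -> C)
    (h : kdist n A) (g : kdist n B) : kdist n C :=
  fun s => match s with
  | Pow k => \sum_(i \in [set i : 'X_{1..n} | (i <= k)%MM])
               op (h (Pow i)) (g (Pow (k - i)%MM))
  | Om k => \sum_(i \in [set: 'X_{1..n}])
               opO (h (Pow i)) (g (Om (k + i)%MM))
          + \sum_(i \in [set: 'X_{1..n}])
               op (h (Om (k + i)%MM)) (g (Pow i))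
  end.

(* Delta(z,w), with integer coefficients; these act on any abelian group. *)
Definition kdelta (n : nat) (N : int) : kdist2 n int :=
  fun s t => match s, t with
  | Om j, Pow k => (j == k)%:R
  | Pow j, Om k => (-1) ^ N * (j == k)%:R
  | _, _ => 0
  end.

Definition mul_zw1 (n : nat) (M : zmodType) (i : 'I_n) (F : kdist2 n M) :
    kdist2 n M :=
  fun s t => mulmon U_(i)%MM F s t - mulmon U_(i)%MM (F s) t.

(* (z - w)^j F, where (z - w)^j = \prod_i (z_i - w_i)^(j_i). *)
Definition mul_zw (n : nat) (M : zmodType) (j : 'X_{1..n}) :
    kdist2 n M -> kdist2 n M :=
  \big[comp/id]_(i < n) iter (j i) (@mul_zw1 n M i).

(* f = \sum_(0 <= j <= K) d_w^(j) Delta(z,w) g^j(w), with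
   g^j(w) = Res_z ((z - w)^j f); the derivative acts on Delta only. *)
Definition local_upto (n : nat) (N : int) (M : zmodType) (K : 'X_{1..n})
    (f : kdist2 n M) :=
  forall s t, f s t =
    \sum_(j \in [set j : 'X_{1..n} | (j <= K)%MM])
      let scale (m : int) (x : M) := x *~ m in
      kmul scale scale (hasse j (kdelta N s)) (resz (mul_zw j f)) t.

Definition local (n : nat) (N : int) (M : zmodType) (f : kdist2 n M) :=
  exists K, local_upto N K f.

(* phi Omega = Omega (tw phi): the component V^i -> V^j of phi has degree j - i,
   hence picks up the sign (-1)^((j - i) N). *)
Definition tw (R : comPzRingType) (V : gradedModule R) (N : int)
    (phi : V -> V) : V -> V :=
  fun v => \sum_(i \in [set: int]) \sum_(j \in [set: int])
    gcomp V j (phi (gcomp V i v)) *~ (-1) ^ ((j - i) * N).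

(* phi s = s (past s phi) for a symbol s. *)
Definition past (R : comPzRingType) (V : gradedModule R) (n : nat) (N : int)
    (s : symb n) (phi : V -> V) : V -> V :=
  if s is Om _ then tw N phi else phi.

(* H(w) g(w) *)
Definition kact (R : comPzRingType) (V : gradedModule R) (n : nat) (N : int)
    (H : kdist n (V -> V)) (g : kdist n V) : kdist n V :=
  kmul (fun phi v => phi v) (fun phi v => tw N phi v) H g.

(* F(z,w) g(w) *)
Definition kact_zw_w (R : comPzRingType) (V : gradedModule R) (n : nat)
    (N : int) (F : kdist2 n (V -> V)) (g : kdist n V) : kdist2 n V :=
  fun s => kact N (F s) g.

(* H(w) G(z,w) *)
Definition kact_w_zw (R : comPzRingType) (V : gradedModule R) (n : nat)
    (N : int) (H : kdist n (V -> V)) (G : kdist2 n V) : kdist2 n V :=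
  fun s => kact N (fun t => past N s (H t)) (G s).

(* A(z) g(w) *)
Definition kact_z_w (R : comPzRingType) (V : gradedModule R) (n : nat)
    (N : int) (A : kdist n (V -> V)) (g : kdist n V) : kdist2 n V :=
  fun s t => past N t (A s) (g t).

(* B(w) g(z); reordering Omega_w Omega_z costs (-1)^N. *)
Definition kact_w_z (R : comPzRingType) (V : gradedModule R) (n : nat)
    (N : int) (B : kdist n (V -> V)) (g : kdist n V) : kdist2 n V :=
  fun s t =>
    let x := past N s (B t) (g s) in
    match s, t with Om _, Om _ => x *~ (-1) ^ N | _, _ => x end.

(* [A(z), B(w)] for A, B homogeneous of degrees p, q. *)
Definition kbracket (R : comPzRingType) (V : gradedModule R) (n : nat)
    (N : int) (p q : int) (A B : kdist n (V -> V)) : kdist2 n (V -> V) :=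
  fun s t v => kact_z_w N A (fun t' => B t' v) s t
    - kact_w_z N B (fun s' => A s' v) s t *~ (-1) ^ (p * q).

(* A(z + w) and A(z - w), expanded in nonnegative powers of w. *)
Definition kshift (n : nat) (M : zmodType) (A : kdist n M) : kdist2 n M :=
  fun s t => if t is Pow k then hasse k A s else 0.

Definition kshiftN (n : nat) (M : zmodType) (A : kdist n M) : kdist2 n M :=
  fun s t => if t is Pow k then hasse k A s *~ (-1) ^+ mdeg k else 0.

(* e^{w.T} and e^{-w.T} *)
Definition kexp (n : nat) (M : zmodType) (T : 'X_{1..n} -> M) : kdist n M :=
  fun t => if t is Pow k then T k else 0.

Definition kexpN (n : nat) (M : zmodType) (T : 'X_{1..n} -> M) : kdist n M :=
  fun t => if t is Pow k then T k *~ (-1) ^+ mdeg k else 0.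

Definition endo (R : comPzRingType) (V : gradedModule R) (phi : {linear V -> V}) :
    V -> V := phi.

(* An (n,N)-cohomological vertex algebra on V.  Since Y(a,z) is linear in a,
   the two cvaY degree conditions say that Y has degree 0, where Omega has
   degree N. *)
Record cva (R : comPzRingType) (n : nat) (N : int) (V : gradedModule R) := CVA {
  cvaY : V -> kdist n {linear V -> V};
  cvaT : 'X_{1..n} -> {linear V -> V};
  cvac : V;
  cvaY_linear : forall s v, linear (fun a => cvaY a s v);
  cvaY_Pow_degree : forall p a j, in_degree p a -> has_degree p (cvaY a (Pow j));
  cvaY_Om_degree : forall p a j,
    in_degree p a -> has_degree (p - N) (cvaY a (Om j));
  cvaT_degree : forall j, has_degree 0 (cvaT j);
  cvaT0 : forall v, cvaT 0%MM v = v;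
  cvac_degree : in_degree 0 cvac;
  cva_field : forall a b, laurent (fun s => cvaY a s b);
  cva_vacuum : forall s b, cvaY cvac s b = kconst b s;
  cva_creation : forall a s, cvaY a s cvac = kexp (fun k => cvaT k a) s;
  cva_translation : forall a v s t,
    kact_w_zw N (kexp (@endo R V \o cvaT))
      (kact_z_w N (@endo R V \o cvaY a) (kexpN (fun k => cvaT k v))) s t
    = kshift (@endo R V \o cvaY a) s t v;
  cva_locality : forall p q a b, in_degree p a -> in_degree q b ->
    local N (kbracket N p q (@endo R V \o cvaY a) (@endo R V \o cvaY b))
}.

(* Y(a, z - w) Y(b, -w) c *)
Definition cva_prod (R : comPzRingType) (n : nat) (N : int)
    (V : gradedModule R) (A : cva n N V) (a b c : V) : kdist2 n V :=
  kact_zw_w N (kshiftN (@endo R V \o cvaY A a)) (kneg N (fun t => cvaY A b t c)).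

(* Y(Y(a, z) b, -w) c *)
Definition cva_iter (R : comPzRingType) (n : nat) (N : int)
    (V : gradedModule R) (A : cva n N V) (a b c : V) : kdist2 n V :=
  fun s => kneg N (fun t => cvaY A (cvaY A a s b) t c).

(* Main.v *)
Require Import Defs.
From mathcomp Require Import all_boot all_order all_algebra.
From mathcomp Require Import boolp classical_sets functions cardinality fsbigop.
From mathcomp Require Import mpoly finmap.
From mathcomp Require Import zify.

(** The bound on the local expansion is the one of the commutator
    [Y(a,z), Y(c,w)], in which b does not occur.  Skew symmetry
      Y(b,-w)c = (-1)^(p(b)p(c)) e^{-w.T} Y(c,w)b
    turns b into the vector on which everything acts.  Together with
    Y(a,z-w) e^{-w.T} = e^{-w.T} Y(a,z), a form of translation covariance, and
    with skew symmetry for the pair (a_s b, c) in the iterate, it gives, for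
    homogeneous a, b, c,
      Y(a,z-w)Y(b,-w)c - Y(Y(a,z)b,-w)c
        = (-1)^(p(b)p(c)) e^{-w.T} [Y(a,z), Y(c,w)] b
    (weak_associator_homog).  Multiplication by a power series in w preserves
    locality with the same bound (local_upto_pow_act), so a bound K for the
    pair (a, c) serves every b.  General a, b, c are sums of homogeneous
    elements; only a and c enlarge the bound.

    Skew symmetry itself comes from evaluating the commutator of a and b on the
    vacuum, where it becomes e^{w.T}Y(a,z-w)b - (sign) e^{z.T}Y(b,w-z)a.
    Locality says that this is a sum of d_w^(j)Delta(z,w) g^j(w) with
    g^j = Res_z (z-w)^j(...) = e^{w.T} a_(j)b.  Delta has no terms without an
    Omega, so the coefficient of z^0 w^k vanishes, which is skew symmetry for
    the coefficients of the w^k; the coefficient of z^0 Omega_w^k expresses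
    b_(k)a through the T^(i)(a_(k+i) b) (skew_symmetry).

    Locality is handled through local_uptoP: any expansion
    f = sum_(j <= K) d_w^(j)Delta(z,w) G^j(w) shows that f is local, since the
    residues of (z-w)^j f then return the G^j (resz_mul_zw).  Signs are handled
    through the parity involution sigma of V: moving an endomorphism phi past
    an Omega replaces it by sigma phi sigma (twE). *)

Set Implicit Arguments.
Unset Strict Implicit.
Unset Printing Implicit Defensive.

Import GRing.Theory.
Local Open Scope ring_scope.

(** * Sums over boxes of multi-indices *)

Section Box.
Variable n : nat.
Implicit Types (i j k l m K B : 'X_{1..n}).

Lemma finite_box K : finite_set [set j : 'X_{1..n} | (j <= K)%MM]%classic.
Proof.
(* The entries of j <= K are at most |K|. *)
pose mnm_of (f : {ffun 'I_n -> 'I_(mdeg K).+1}) := [multinom f i : nat | i < n].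
apply: (@sub_finite_set _ _ (mnm_of @` setT)%classic);
  last exact/finite_image/finite_finset.
move=> j /= /mnm_lepP jK; exists [ffun i => inord (j i)] => //.
apply/mnmP => i; rewrite mnmE ffunE inordK // ltnS (leq_trans (jK i)) //.
by rewrite mdegE (bigD1 i) //= leq_addr.
Qed.

Definition box K : seq 'X_{1..n} := fset_set [set j : 'X_{1..n} | (j <= K)%MM]%classic.

Lemma mem_box K j : (j \in box K) = (j <= K)%MM.
Proof. 
rewrite /box (in_fset_set (finite_box K)).
by apply/idP/idP => [/set_mem|?] //; apply/mem_set.
Qed.

Lemma uniq_box K : uniq (box K).
Proof. exact: fset_uniq. Qed.

Lemma fsum_box (M : nmodType) K (F : 'X_{1..n} -> M) :
  \sum_(j \in [set j : 'X_{1..n} | (j <= K)%MM]%classic) F j = \sum_(j <- box K) F j.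
Proof. by rewrite (fsbig_finite _ _ (finite_box K)). Qed.

Lemma fsumT_box (M : nmodType) B (F : 'X_{1..n} -> M) :
  (forall i, ~~ (i <= B)%MM -> F i = 0) ->
  \sum_(i \in [set: 'X_{1..n}]%classic) F i = \sum_(i <- box B) F i.
Proof.
move=> F0; rewrite -fsum_box; apply/esym/fsbig_widen => // i [_ /= /negP iB].
exact: F0.
Qed.

Lemma fsumT_delta (M : nmodType) k (F : 'X_{1..n} -> M) :
  (forall i, i != k -> F i = 0) ->
  \sum_(i \in [set: 'X_{1..n}]%classic) F i = F k.
Proof.
move=> F0; rewrite -(@fsbig_widen _ _ 0 +%R [set k]%classic) ?fsbig_set1//.
by move=> i [_ /= /eqP ik]; exact: F0.
Qed.

Lemma box_delta (M : nmodType) K k (F : 'X_{1..n} -> M) :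
  (forall i, i != k -> F i = 0) ->
  \sum_(i <- box K) F i = if (k <= K)%MM then F k else 0.
Proof.
move=> F0; rewrite -mem_box; case: ifPn => kK.
  by rewrite (bigD1_seq k) ?uniq_box //= big1 ?addr0 // => i ik; exact: F0.
by rewrite big_seq big1 // => i iK; apply: F0; apply: contraNneq kK => <-.
Qed.

Lemma box_shrink (M : nmodType) K B (F : 'X_{1..n} -> M) : (K <= B)%MM ->
  (forall i, (i <= B)%MM -> ~~ (i <= K)%MM -> F i = 0) ->
  \sum_(i <- box B) F i = \sum_(i <- box K) F i.
Proof.
move=> KB F0; rewrite -!fsum_box; apply/esym/fsbig_widen => [i /= iK|i [/= iB /negP]].
  exact: lepm_trans KB.
exact: F0.
Qed.

Lemma box_mkcond (M : nmodType) B m (F : 'X_{1..n} -> M) : (m <= B)%MM ->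
  \sum_(i <- box m) F i = \sum_(i <- box B | (i <= m)%MM) F i.
Proof.
move=> mB; rewrite [RHS]big_mkcond.
rewrite (box_shrink (B := B) (K := m)) //= => [|i _ /negbTE ->] //.
by apply: eq_big_seq => i; rewrite mem_box => ->.
Qed.

Lemma box_translate (M : nmodType) B i (F : 'X_{1..n} -> M) : (i <= B)%MM ->
  \sum_(m <- box B | (i <= m)%MM) F (m - i)%MM = \sum_(l <- box (B - i)) F l.
Proof.
move=> iB; rewrite -big_filter -[RHS]fsum_box.
have -> : \sum_(m <- [seq m <- box B | (i <= m)%MM]) F (m - i)%MM =
  \sum_(m \in [set m : 'X_{1..n} | (m <= B)%MM /\ (i <= m)%MM]%classic) F (m - i)%MM.
  rewrite fsbig_seq ?filter_uniq ?uniq_box //; apply: eq_fsbigl.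
  by apply/seteqP; split=> m /=; rewrite mem_filter mem_box;
    [move=> /andP[] | move=> [-> ->]].
apply/esym/(reindex_fsbig (fun m => (m - i)%MM)); split=> [m [] /= + _|x y|l /=].
- by move=> /mnm_lepP mB; apply/mnm_lepP => k; rewrite !mnmBE leq_sub2r.
- move=> /set_mem[_ ix] /set_mem[_ iy] /(congr1 (fun m => m + i)%MM).
  by rewrite !(submK ix, submK iy).
- move=> lB; exists (l + i)%MM => /=; last by rewrite addmK.
  split; last exact: lem_addl.
  apply/mnm_lepP => k.
  by move/mnm_lepP/(_ k): lB; move/mnm_lepP/(_ k): iB; rewrite mnmBE mnmDE; lia.
Qed.

(** Rearrangement by m = i + l, the form in which products of power series are
    expanded. *)
Lemma cauchy_box (M : nmodType) B (F : 'X_{1..n} -> 'X_{1..n} -> M) :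
  (forall i l, ~~ (i + l <= B)%MM -> F i l = 0) ->
  \sum_(i <- box B) \sum_(l <- box B) F i l
  = \sum_(m <- box B) \sum_(i <- box m) F i (m - i)%MM.
Proof.
move=> F0.
transitivity (\sum_(m <- box B) \sum_(i <- box B | (i <= m)%MM) F i (m - i)%MM).
  rewrite [RHS](exchange_big_dep xpredT) //=; apply: eq_big_seq => i.
  rewrite mem_box => iB; rewrite box_translate //.
  apply: box_shrink => [|l _ lB]; first exact: lem_subr.
  apply: F0; apply: contra lB => /mnm_lepP H; apply/mnm_lepP => k.
  by move: (H k); rewrite mnmBE mnmDE; lia.
by apply: eq_big_seq => m; rewrite mem_box => mB; rewrite (box_mkcond _ mB).
Qed.

Lemma box_rev (M : nmodType) k (F : 'X_{1..n} -> M) :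
  \sum_(i <- box k) F i = \sum_(i <- box k) F (k - i)%MM.
Proof.
rewrite -!fsum_box; apply: (reindex_fsbig (fun i => k - i)%MM).
have kk i : (i <= k)%MM -> (k - (k - i) = i)%MM.
  by move=> ik; rewrite submBA // addmC addmK.
split=> [i _|x y|l /= lk] /=; first exact: lem_subr.
  by move=> /set_mem /= xk /set_mem /= yk /(congr1 (fun m => k - m)%MM); rewrite !kk.
by exists (k - l)%MM => /=; [exact: lem_subr | rewrite kk].
Qed.

Lemma box_swap (M : nmodType) k m (F : 'X_{1..n} -> M) :
  \sum_(l <- box k | (l <= m)%MM) F l = \sum_(l <- box m | (l <= k)%MM) F l.
Proof.
rewrite [LHS]big_mkcond [RHS]big_mkcond /= (box_mkcond _ (lem_addr k m)).
rewrite (box_mkcond _ (lem_addl k m)) -!big_mkcondr /=.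
by apply: eq_bigl => l; rewrite andbC.
Qed.

End Box.

(** * Multi-index binomial coefficients *)

Section Binomial.
Variable n : nat.
Implicit Types (j k m x : 'X_{1..n}).

Lemma mbin_small m j : ~~ (j <= m)%MM -> mbin m j = 0%N.
Proof.
move=> /forallPn[i]; rewrite -ltnNge => mj.
by rewrite /mbin (bigD1 i) //= bin_small.
Qed.

Lemma mbinn m : mbin m m = 1%N.
Proof. by rewrite /mbin big1 // => i _; rewrite binn. Qed.

Lemma mbin_sub m j : (j <= m)%MM -> mbin m (m - j)%MM = mbin m j.
Proof.
move=> /mnm_lepP jm; apply: eq_bigr => i _.
by rewrite mnmBE bin_sub.
Qed.

Lemma mbin0n j : mbin 0%MM j = (j == 0%MM).
Proof.
have [->|j0] := eqVneq j 0%MM; first by rewrite mbinn.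
apply: mbin_small; apply: contra j0 => /mnm_lepP H; apply/eqP/mnmP => i.
by move: (H i); rewrite mnm0E; lia.
Qed.

Lemma mbin_pascal m x (l : 'I_n) :
  mbin (m + U_(l))%MM x
  = (mbin m x + (if (0 < x l)%N then mbin m (x - U_(l))%MM else 0))%N.
Proof.
rewrite /mbin !(bigD1 l (P := xpredT)) //=.
have -> : (\prod_(i < n | i != l) 'C((m + U_(l))%MM i, x i) =
           \prod_(i < n | i != l) 'C(m i, x i))%N.
  by apply: eq_bigr => i /negbTE il; rewrite mnmDE mnm1E eq_sym il addn0.
have -> : (\prod_(i < n | i != l) 'C(m i, (x - U_(l))%MM i) =
           \prod_(i < n | i != l) 'C(m i, x i))%N.
  by apply: eq_bigr => i /negbTE il; rewrite mnmBE mnm1E eq_sym il subn0.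
rewrite mnmDE mnmBE mnm1E eqxx addn1 subn1.
by case: (x l) => [|y] /=; rewrite ?bin0 ?addn0 // binS mulnDl.
Qed.

End Binomial.

(** * Multiplication by a power or by an Omega *)

Section Shifts.
Variable n : nat.
Implicit Types (i j k m : 'X_{1..n}) (t : symb n).

Lemma mulmon0 (M : zmodType) (g : kdist n M) t : mulmon 0%MM g t = g t.
Proof. 
case: t => k; rewrite /= ?addm0 // subm0.
have -> : (0 <= k)%MM by apply/mnm_lepP => i; rewrite mnm0E.
by [].
Qed.

Lemma mulmonD (M : zmodType) i j (g : kdist n M) t :
  mulmon i (mulmon j g) t = mulmon (i + j)%MM g t.
Proof.
case: t => k /=; last by rewrite -addmA.
have -> : (i + j <= k)%MM = (i <= k)%MM && (j <= k - i)%MM.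
  apply/mnm_lepP/andP => [H|[/mnm_lepP ik /mnm_lepP jk] x].
    by split; apply/mnm_lepP => x; move: (H x); rewrite ?mnmBE mnmDE; lia.
  by move: (ik x) (jk x); rewrite mnmBE mnmDE; lia.
by rewrite submDA; case: ifP.
Qed.

Lemma mulmon_map (M M' : zmodType) (phi : M -> M') m (g : kdist n M) t :
  phi 0 = 0 -> mulmon m (fun t' => phi (g t')) t = phi (mulmon m g t).
Proof. by move=> phi0; case: t => k //=; case: ifP. Qed.

Lemma mulmon_sum (M : zmodType) (I : Type) (r : seq I) (P : pred I) m
    (g : I -> kdist n M) t :
  mulmon m (fun t' => \sum_(j <- r | P j) g j t') t
  = \sum_(j <- r | P j) mulmon m (g j) t.
Proof. by case: t => k //=; case: ifP => // _; rewrite big1. Qed.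

(** The product of Omega^k and g. *)
Definition mulom (M : zmodType) (k : 'X_{1..n}) (g : kdist n M) : kdist n M :=
  fun t => if t is Om l then if (l <= k)%MM then g (Pow (k - l)%MM) else 0 else 0.

Lemma mulom_map (M M' : zmodType) (phi : M -> M') m (g : kdist n M) t :
  phi 0 = 0 -> mulom m (fun t' => phi (g t')) t = phi (mulom m g t).
Proof. by move=> phi0; case: t => k //=; case: ifP. Qed.

Lemma mulom_sum (M : zmodType) (I : Type) (r : seq I) (P : pred I) m
    (g : I -> kdist n M) t :
  mulom m (fun t' => \sum_(j <- r | P j) g j t') t
  = \sum_(j <- r | P j) mulom m (g j) t.
Proof. by case: t => k //=; [rewrite big1 | case: ifP => // _; rewrite big1]. Qed.

Lemma mulmon_mulom (M : zmodType) i k (g : kdist n M) t :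
  mulmon i (mulom k g) t = mulom k (mulmon i g) t.
Proof.
case: t => l /=; first by rewrite if_same.
have [lik|nlik] := boolP (l + i <= k)%MM.
  have H x : (l x + i x <= k x)%N by move/mnm_lepP/(_ x): lik; rewrite mnmDE.
  rewrite !ifT ?submDA //; apply/mnm_lepP => x; move: (H x); rewrite ?mnmBE; lia.
case: ifPn => // lk; case: ifPn => // ik; case/negP: nlik; apply/mnm_lepP => x.
by move/mnm_lepP/(_ x): lk; move/mnm_lepP/(_ x): ik; rewrite mnmBE mnmDE; lia.
Qed.

End Shifts.

(** * Expansions in derivatives of Delta *)

Section Delta.
Variables (n : nat) (N : int).
Implicit Types (i j k m : 'X_{1..n}) (s t : symb n).

(** The product of d_w^(j) Delta(z,w) and g(w), written out with
    d_w^(j) Delta = sum_m ('C(m, j) w^(m-j) Omega_z^m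
      + (-1)^(N+|j|) 'C(m+j, j) z^m Omega_w^(m+j)).
    When j <= m fails, m - j is truncated and the binomial coefficient is 0. *)
Definition delta_term (M : zmodType) j (g : kdist n M) : kdist2 n M :=
  fun s t => match s with
  | Om m => mulmon (m - j)%MM g t *~ (mbin m j)%:Z
  | Pow m => mulom (m + j)%MM g t
             *~ ((-1) ^ N * ((-1) ^+ mdeg j * (mbin (m + j)%MM j)%:Z))
  end.

Lemma hasse_delta_Om j m i :
  hasse j (kdelta N (Om m)) (Pow i) = if i == (m - j)%MM then (mbin m j)%:Z else 0.
Proof.
rewrite /=; have [->|im] := eqVneq i (m - j)%MM.
  have [jm|jm] := boolP (j <= m)%MM; first by rewrite submK // eqxx mulr1n natz.
  have -> : (m == m - j + j)%MM = false.
    by apply: contraNF jm => /eqP H; rewrite H lem_addl.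
  by rewrite (mbin_small jm) -mulrnA mul0n.
have -> : (m == i + j)%MM = false.
  by apply: contraNF im => /eqP ->; rewrite addmK.
by rewrite -mulrnA mul0n.
Qed.

Lemma hasse_delta_Pow j m k :
  hasse j (kdelta N (Pow m)) (Om k)
  = if k == (m + j)%MM then (-1) ^ N * ((-1) ^+ mdeg j * (mbin (m + j)%MM j)%:Z) else 0.
Proof.
rewrite /=; have [->|km] := eqVneq k (m + j)%MM.
  by rewrite lem_addl addmK eqxx mulr1 mulrzz.
case: ifPn => // jk; have -> : (m == k - j)%MM = false.
  by apply: contraNF km => /eqP ->; rewrite submK.
by rewrite mulr0 mul0rz.
Qed.

Lemma kmul_deltaE (M : zmodType) j (g : kdist n M) s t :
  kmul (fun (m : int) (x : M) => x *~ m) (fun (m : int) (x : M) => x *~ m)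
    (hasse j (kdelta N s)) g t = delta_term j g s t.
Proof.
case: s => m; last first.
  have hP := hasse_delta_Om j m.
  have hO k : hasse j (kdelta N (Om m)) (Om k) = 0 by rewrite /= mul0rz if_same.
  case: t => k; rewrite /kmul /delta_term.
    rewrite fsum_box (@box_delta _ _ _ (m - j)%MM) => [|i im]; last first.
      by rewrite hP (negbTE im) mulr0z.
    by rewrite hP eqxx /=; case: ifP => //; rewrite mul0rz.
  rewrite (@fsumT_delta _ _ (m - j)%MM) => [|i im]; last first.
    by rewrite hP (negbTE im) mulr0z.
  rewrite hP eqxx fsbig1 ?addr0 // => i _; by rewrite hO mulr0z.
have hP i : hasse j (kdelta N (Pow m)) (Pow i) = 0 by rewrite /= mul0rn.
have hO := hasse_delta_Pow j m.
case: t => k; rewrite /kmul /delta_term.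
  by rewrite fsbig1 => [|i _]; [rewrite /= mul0rz | rewrite hP mulr0z].
rewrite fsbig1 ?add0r => [|i _]; last by rewrite hP mulr0z.
rewrite (@fsumT_delta _ _ (m + j - k)%MM) => [|i ik]; last first.
  rewrite hO ifF ?mulr0z //; apply: contraNF ik => /eqP <-.
  by rewrite addmC addmK.
rewrite hO /=; have [km|km] := boolP (k <= m + j)%MM.
  by rewrite [(k + _)%MM]addmC submK // eqxx.
rewrite ifF ?mulr0z ?mul0rz //; apply: contraNF km => /eqP <-; exact: lem_addr.
Qed.

Lemma local_uptoE (M : zmodType) K (f : kdist2 n M) :
  local_upto N K f <-> forall s t, f s t =
    \sum_(j <- box K) delta_term j (resz (mul_zw j f)) s t.
Proof.
have H s t : \sum_(j \in [set j : 'X_{1..n} | (j <= K)%MM]%classic)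
      (let scale (m : int) (x : M) := x *~ m in
      kmul scale scale (hasse j (kdelta N s)) (resz (mul_zw j f)) t)
    = \sum_(j <- box K) delta_term j (resz (mul_zw j f)) s t.
  by rewrite fsum_box; apply: eq_bigr => j _; exact: kmul_deltaE.
by split=> E s t; rewrite E H.
Qed.

(** As (z-w)^d d_w^(i)Delta is d_w^(i-d)Delta if d <= i and 0 otherwise, this
    is the shape, on the coefficients of the Omega_z^m, of
    (z-w)^d sum_(i <= K) d_w^(i)Delta G^i.  The residues used in the
    definition of locality only see these coefficients. *)
Definition om_expansion (M : zmodType) K (G : 'X_{1..n} -> kdist n M) d
    (F : kdist2 n M) :=
  forall m t, F (Om m) t = \sum_(i <- box K | (d <= i)%MM)
    mulmon (m - (i - d))%MM (G i) t *~ (mbin m (i - d)%MM)%:Z.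

(** Pascal's rule: (z_l - w_l) d_w^(x)Delta is d_w^(x - e_l)Delta, or 0 when
    x_l = 0. *)
Lemma mulmon_binomial_step (M : zmodType) (g : kdist n M) (l : 'I_n) m x t :
  mulmon (m + U_(l) - x)%MM g t *~ (mbin (m + U_(l)) x)%:Z
  - mulmon (U_(l) + (m - x))%MM g t *~ (mbin m x)%:Z
  = if (0 < x l)%N then mulmon (m - (x - U_(l)))%MM g t *~ (mbin m (x - U_(l)))%:Z
    else 0.
Proof.
rewrite mbin_pascal; case: ifPn => xl; last first.
  rewrite addn0 (_ : m + U_(l) - x = U_(l) + (m - x))%MM ?subrr //.
  apply/mnmP => k; rewrite !(mnmBE, mnmDE, mnm1E).
  by case: eqP xl => [<-|_]; lia.
have -> : (m + U_(l) - x = m - (x - U_(l)))%MM.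
  apply/mnmP => k; rewrite !(mnmBE, mnmDE, mnm1E).
  by case: eqP xl => [<-|_]; lia.
have [xm|xm] := boolP (x <= m)%MM; last first.
  by rewrite (mbin_small xm) add0n mulr0z subr0.
have -> : (U_(l) + (m - x) = m - (x - U_(l)))%MM.
  apply/mnmP => k; move/mnm_lepP/(_ k): xm; rewrite !(mnmBE, mnmDE, mnm1E).
  by case: eqP xl => [<-|_]; lia.
by rewrite PoszD mulrzDr addrC addKr.
Qed.

Lemma om_expansion_mul_zw1 (M : zmodType) K G d (F : kdist2 n M) (l : 'I_n) :
  om_expansion K G d F -> om_expansion K G (d + U_(l))%MM (mul_zw1 l F).
Proof.
move=> EF m t; rewrite /mul_zw1 [mulmon _ F _]/= EF.
rewrite (_ : F (Om m) = fun t => \sum_(i <- box K | (d <= i)%MM)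
    mulmon (m - (i - d))%MM (G i) t *~ (mbin m (i - d)%MM)%:Z); last exact/funext/EF.
rewrite mulmon_sum -sumrB [RHS]big_mkcond [LHS]big_mkcond /=; apply: eq_bigr => i _.
case: ifPn => di; last first.
  rewrite ifF //; apply: contraNF di => /mnm_lepP H; apply/mnm_lepP => k.
  by move: (H k); rewrite mnmDE; lia.
rewrite (mulmon_map (phi := fun x => x *~ _)) ?mul0rz // mulmonD mulmon_binomial_step.
have -> : (0 < (i - d)%MM l)%N = (d + U_(l) <= i)%MM.
  rewrite mnmBE subn_gt0; apply/idP/mnm_lepP => [dl k|/(_ l)].
    move/mnm_lepP/(_ k): di; rewrite mnmDE mnm1E.
    by case: eqP dl => [<-|_]; lia.
  by rewrite mnmDE mnm1E eqxx addn1.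
by case: ifP => // _; rewrite submDA.
Qed.

Lemma om_expansion_mul_zw (M : zmodType) K G (F : kdist2 n M) j :
  om_expansion K G 0%MM F -> om_expansion K G j (mul_zw j F).
Proof.
move=> EF; rewrite /mul_zw.
suff H (r : seq 'I_n) : om_expansion K G (\sum_(l <- r) U_(l) *+ j l)%MM
    ((\big[comp/id]_(l <- r) iter (j l) (@mul_zw1 n M l)) F).
  have := H (index_enum 'I_n); congr (om_expansion K G _ _).
  by rewrite -multinomUE_id.
elim: r => [|l r IH]; first by rewrite !big_nil.
rewrite !big_cons /=; elim: (j l) => [|e IHe] /=; first by rewrite mulm0n add0m.
by rewrite mulmSr -addmA [(U_(l) + _)%MM]addmC addmA; exact: om_expansion_mul_zw1.
Qed.

Lemma resz_mul_zw (M : zmodType) K G (F : kdist2 n M) j t :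
  om_expansion K G 0%MM F ->
  resz (mul_zw j F) t = if (j <= K)%MM then G j t else 0.
Proof.
move=> /om_expansion_mul_zw -/(_ j) E; rewrite /resz E big_mkcond /=.
rewrite (@box_delta _ _ _ j) => [|i ij].
  rewrite lepm_refl mbin0n (_ : j - j = 0)%MM ?eqxx ?subm0 ?mulmon0 //.
  by rewrite -{1}[j]add0m addmK.
case: ifPn => // ji; rewrite mbin0n; case: eqP => [H|_]; last by rewrite mulr0z.
by move/eqP: ij; rewrite -(submK ji) H add0m.
Qed.

(** The coefficients need not be given as residues.  This makes closure under
    sums, additive maps and larger bounds a matter of operating on G. *)
Lemma local_uptoP (M : zmodType) K (f : kdist2 n M) :
  local_upto N K f <->
  exists G, forall s t, f s t = \sum_(j <- box K) delta_term j (G j) s t.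
Proof.
rewrite local_uptoE; split=> [E|[G E]]; first by exists (fun j => resz (mul_zw j f)).
have OE : om_expansion K G 0%MM f.
  move=> m t; rewrite E [RHS](eq_bigl xpredT) => [|i].
    by apply: eq_bigr => i _; rewrite subm0.
  by apply/mnm_lepP => k; rewrite mnm0E.
move=> s t; rewrite E; apply: eq_big_seq => j; rewrite mem_box => jK.
by congr (delta_term _ _ _ _); apply/funext => u; rewrite (resz_mul_zw _ _ OE) jK.
Qed.

End Delta.

(** * Additive maps

    Stated for a predicate rather than for bundled morphisms, as the maps they
    are applied to, such as past N s phi, are bare functions. *)

Section Morph.
Variables (U V : zmodType) (f : U -> V) (hf : zmod_morphism f).

Lemma zmorph0 : f 0 = 0. Proof. by rewrite -{1}(subrr 0) hf subrr. Qed.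

Lemma zmorphN x : f (- x) = - f x.
Proof. by rewrite -sub0r hf zmorph0 sub0r. Qed.

Lemma zmorphD x y : f (x + y) = f x + f y.
Proof. by rewrite -{1}[y]opprK hf zmorphN opprK. Qed.

Lemma zmorph_sum (I : Type) (r : seq I) (P : pred I) F :
  f (\sum_(i <- r | P i) F i) = \sum_(i <- r | P i) f (F i).
Proof. exact: (big_morph f zmorphD zmorph0). Qed.

Lemma zmorphMz x (m : int) : f (x *~ m) = f x *~ m.
Proof.
have Mn k : f (x *+ k) = f x *+ k 
  by elim: k => [|k IH]; rewrite ?mulr0n ?zmorph0 // !mulrS zmorphD IH.
by case: m => k; rewrite ?NegzE ?mulrNz ?zmorphN -?pmulrn Mn.
Qed.

End Morph.

(** * Closure properties of locality *)

Section LocalClosure.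
Variables (n : nat) (N : int).
Implicit Types (i j k m K B : 'X_{1..n}) (s t : symb n).

Lemma delta_term_map (M M' : zmodType) (phi : M -> M') j (g : kdist n M) s t :
  zmod_morphism phi ->
  delta_term N j (fun t' => phi (g t')) s t = phi (delta_term N j g s t).
Proof.
move=> hphi; have p0 := zmorph0 hphi.
by case: s => m /=; rewrite ?(mulmon_map _ _ _ p0) ?(mulom_map _ _ _ p0) zmorphMz.
Qed.

Lemma delta_term_sum (M : zmodType) (I : Type) (r : seq I) j
    (g : I -> kdist n M) s t :
  delta_term N j (fun t' => \sum_(i <- r) g i t') s t
  = \sum_(i <- r) delta_term N j (g i) s t.
Proof. by case: s => m /=; rewrite ?mulmon_sum ?mulom_sum mulrz_suml. Qed.

Lemma delta_term0 (M : zmodType) j s t :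
  delta_term N j (fun=> 0 : M) s t = 0.
Proof.
by case: s t => m [] k; rewrite /= ?if_same mul0rz.
Qed.

Lemma delta_termD (M : zmodType) j (g h : kdist n M) s t :
  delta_term N j (fun t' => g t' + h t') s t
  = delta_term N j g s t + delta_term N j h s t.
Proof.
have := delta_term_sum [:: true; false] j (fun b : bool => if b then g else h) s t.
rewrite !big_cons !big_nil addr0 => <-; congr (delta_term _ _ _ _ _).
by apply/funext => u; rewrite !big_cons !big_nil addr0.
Qed.

Lemma local_upto_map (M M' : zmodType) (phi : M -> M') K (f : kdist2 n M) :
  zmod_morphism phi -> local_upto N K f ->
  local_upto N K (fun s t => phi (f s t)).
Proof.
move=> hphi /local_uptoP[G E]; apply/local_uptoP.
exists (fun j t => phi (G j t)) => s t; rewrite E zmorph_sum //.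
by apply: eq_bigr => j _; rewrite delta_term_map.
Qed.

Lemma local_uptoD (M : zmodType) K (f g : kdist2 n M) :
  local_upto N K f -> local_upto N K g ->
  local_upto N K (fun s t => f s t + g s t).
Proof.
move=> /local_uptoP[F EF] /local_uptoP[G EG]; apply/local_uptoP.
exists (fun j t => F j t + G j t) => s t; rewrite EF EG -big_split /=.
by apply: eq_bigr => j _; rewrite delta_termD.
Qed.

Lemma local_upto_le (M : zmodType) K K' (f : kdist2 n M) : (K <= K')%MM ->
  local_upto N K f -> local_upto N K' f.
Proof.
move=> KK /local_uptoP[F EF]; apply/local_uptoP.
exists (fun j t => if (j <= K)%MM then F j t else 0) => s t.
rewrite EF (box_shrink (B := K') (K := K)) // => [|j _ /negbTE jK].
  by apply: eq_big_seq => j; rewrite mem_box => ->.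
have -> : (fun u => if (j <= K)%MM then F j u else 0) = (fun=> 0).
  by apply/funext => u; rewrite jK.
exact: delta_term0.
Qed.

End LocalClosure.

(** * The action of a power series of operators *)

Section PowerSeriesAction.
Variables (n : nat).
Implicit Types (i j k m K B : 'X_{1..n}) (s t : symb n).

(** The product of sum_i w^i H_i and g(w), uniformly for both kinds of
    coefficients.  For laurent g each coefficient of the product is a finite
    sum. *)
Definition pow_act (M M' : zmodType) (H : 'X_{1..n} -> M -> M') (g : kdist n M) :
    kdist n M' :=
  fun t => \sum_(i \in [set: 'X_{1..n}]%classic) H i (mulmon i g t).

(** Bounds the sum that defines the coefficient at t of a product with g. *)
Definition shift_bound (M : zmodType) B (g : kdist n M) t :=
  forall i, ~~ (i <= B)%MM -> mulmon i g t = 0.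

Lemma laurent_shift_bound (M : zmodType) (g : kdist n M) t :
  laurent g -> exists B, shift_bound B g t.
Proof.
move=> [K gK]; exists (if t is Pow k then k else K) => i; case: t => k /=.
  by move/negbTE ->.
move=> iK; apply: gK; apply: contra iK => /mnm_lepP H; apply/mnm_lepP => x.
by move: (H x); rewrite mnmDE; lia.
Qed.

Lemma shift_bound_le (M : zmodType) B B' (g : kdist n M) t :
  (B <= B')%MM -> shift_bound B g t -> shift_bound B' g t.
Proof. by move=> BB gB i iB; apply: gB; apply: contra iB => /lepm_trans; apply. Qed.

Lemma laurent_mulmon (M : zmodType) m (g : kdist n M) :
  laurent g -> laurent (mulmon m g).
Proof.
move=> [K gK]; exists K => k kK; apply: gK; apply: contra kK.
by apply: lepm_trans; exact: lem_addr.
Qed.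

Lemma laurentB (M : zmodType) (g h : kdist n M) :
  laurent g -> laurent h -> laurent (fun t => g t - h t).
Proof.
move=> [K gK] [L hL]; exists (K + L)%MM => k kKL; rewrite gK ?hL ?subrr //;
  apply: contra kKL => /lepm_trans; apply; [exact: lem_addl | exact: lem_addr].
Qed.

Lemma laurent_sum (M : zmodType) (I : Type) (r : seq I) (g : I -> kdist n M) :
  (forall a, laurent (g a)) -> laurent (fun t => \sum_(a <- r) g a t).
Proof.
move=> gL; elim: r => [|a r [K rK]]; first by exists 0%MM => k _; rewrite big_nil.
have [L gaL] := gL a; exists (K + L)%MM => k kKL; rewrite big_cons gaL ?rK ?addr0 //;
  apply: contra kKL => /lepm_trans; apply; [exact: lem_addr | exact: lem_addl].
Qed.

Lemma laurent_map (M M' : zmodType) (phi : M -> M') (g : kdist n M) :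
  phi 0 = 0 -> laurent g -> laurent (fun t => phi (g t)).
Proof. by move=> p0 [K gK]; exists K => k kK; rewrite gK. Qed.

Lemma laurent_delta_term (M : zmodType) N j (g : kdist n M) s :
  laurent g -> laurent (delta_term N j g s).
Proof.
case: s => m gL /=.
  exists (m + j)%MM => k /negbTE kmj; by rewrite /= kmj mul0rz.
by apply: (laurent_map (phi := fun x => x *~ _)); [rewrite mul0rz | exact: laurent_mulmon].
Qed.

Section Theory.
Variables (M M' : zmodType) (H : 'X_{1..n} -> M -> M').
Hypothesis hH : forall i, zmod_morphism (H i).

Let H0 i : H i 0 = 0. Proof. exact: zmorph0. Qed.

Lemma pow_act_box B (g : kdist n M) t : shift_bound B g t ->
  pow_act H g t = \sum_(i <- box B) H i (mulmon i g t).
Proof. by move=> gB; apply: fsumT_box => i iB; rewrite gB. Qed.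

Lemma laurent_pow_act (g : kdist n M) : laurent g -> laurent (pow_act H g).
Proof.
move=> [K gK]; exists K => k kK; rewrite /pow_act fsbig1 // => i _ /=.
by rewrite gK //; apply: contra kK; apply: lepm_trans; exact: lem_addr.
Qed.

Lemma pow_act_mulmon m (g : kdist n M) t :
  mulmon m (pow_act H g) t = pow_act H (mulmon m g) t.
Proof.
have E i : mulmon i (mulmon m g) = mulmon m (mulmon i g).
  by apply/funext => u; rewrite !mulmonD addmC.
rewrite /pow_act; under [RHS]eq_fsbigr => i _ do rewrite E.
case: t => k //=; case: ifP => // _; by rewrite fsbig1 // => i _; rewrite H0.
Qed.

Lemma pow_act_mulom m (g : kdist n M) t :
  mulom m (pow_act H g) t = pow_act H (mulom m g) t.
Proof.
rewrite /pow_act; under [RHS]eq_fsbigr => i _ do rewrite mulmon_mulom.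
case: t => k //=; first by rewrite fsbig1.
by case: ifP => // _; rewrite fsbig1 // => i _; rewrite H0.
Qed.

Lemma pow_actMz (g : kdist n M) (c : int) t : laurent g ->
  pow_act H (fun t' => g t' *~ c) t = pow_act H g t *~ c.
Proof.
move=> /laurent_shift_bound-/(_ t)[B gB].
have E i : mulmon i (fun t' => g t' *~ c) t = mulmon i g t *~ c.
  by rewrite (mulmon_map (phi := fun x => x *~ c)) ?mul0rz.
rewrite !(@pow_act_box B) // => [|i iB]; last by rewrite E gB // mul0rz.
by rewrite mulrz_suml; apply: eq_bigr => i _; rewrite E zmorphMz.
Qed.

Lemma pow_actD (g h : kdist n M) t : laurent g -> laurent h ->
  pow_act H (fun t' => g t' + h t') t = pow_act H g t + pow_act H h t.
Proof.
move=> /laurent_shift_bound-/(_ t)[B gB] /laurent_shift_bound-/(_ t)[B' hB].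
have {}gB := shift_bound_le (lem_addr B B') gB.
have {}hB := shift_bound_le (lem_addl B B') hB.
have E i : mulmon i (fun t' => g t' + h t') t = mulmon i g t + mulmon i h t.
  by case: t {gB hB} => k //=; case: ifP; rewrite ?addr0.
rewrite !(@pow_act_box (B + B')%MM) // => [|i iB]; last by rewrite E gB ?hB ?addr0.
by rewrite -big_split; apply: eq_bigr => i _; rewrite E zmorphD.
Qed.

Lemma pow_act_sum (I : Type) (r : seq I) (g : I -> kdist n M) t :
  (forall a, laurent (g a)) ->
  pow_act H (fun t' => \sum_(a <- r) g a t') t = \sum_(a <- r) pow_act H (g a) t.
Proof.
move=> gL; elim: r => [|a r IH].
  rewrite big_nil /pow_act fsbig1 // => i _.
  by rewrite mulmon_sum big_nil H0.
rewrite big_cons -IH -pow_actD //; last exact: laurent_sum.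
by congr (pow_act _ _ _); apply/funext => u; rewrite big_cons.
Qed.

Lemma pow_act_delta_term N j (g : kdist n M) s t : laurent g ->
  pow_act H (delta_term N j g s) t = delta_term N j (pow_act H g) s t.
Proof.
move=> gL; case: s => m /=; rewrite pow_actMz ?pow_act_mulom ?pow_act_mulmon //.
  by exists (m + j)%MM => k /negbTE /= ->.
exact: laurent_mulmon.
Qed.

End Theory.

Lemma laurent_resz_mul_zw (M : zmodType) j (f : kdist2 n M) :
  (forall s, laurent (f s)) -> laurent (resz (mul_zw j f)).
Proof.
move=> fL; rewrite /resz /mul_zw; set s := Om _; clearbody s; move: s.
elim: (index_enum _) => [|l r IH]; rewrite ?big_nil // big_cons /=.
elim: (j l) => [|e IHe] //= s; rewrite /mul_zw1.
apply: laurentB; last exact: laurent_mulmon.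
by case: s => k //=; case: ifP => // _; exists 0%MM.
Qed.

(** A power series in w may be moved past Delta, hence onto the coefficients
    g^j(w) of the local expansion.  The laurent hypothesis on the slices is what
    makes the products involved exist; it passes to the residues g^j. *)
Lemma local_upto_pow_act (M M' : zmodType) (H : 'X_{1..n} -> M -> M') N K
    (f : kdist2 n M) : (forall i, zmod_morphism (H i)) ->
  (forall s, laurent (f s)) -> local_upto N K f ->
  local_upto N K (fun s => pow_act H (f s)).
Proof.
move=> hH fL /local_uptoE E; apply/local_uptoP.
exists (fun j => pow_act H (resz (mul_zw j f))) => s t.
have -> : f s = fun t => \sum_(j <- box K) delta_term N j (resz (mul_zw j f)) s t.
  by apply/funext => u; rewrite E.
have L j : laurent (resz (mul_zw j f)) by exact: laurent_resz_mul_zw.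
rewrite pow_act_sum // => [|j]; last exact: laurent_delta_term.
by apply: eq_bigr => j _; rewrite pow_act_delta_term.
Qed.

Lemma pow_act_comp (M M' M'' : zmodType) (H : 'X_{1..n} -> M' -> M'')
    (H' : 'X_{1..n} -> M -> M') (g : kdist n M) t :
  (forall i, zmod_morphism (H i)) -> (forall i, zmod_morphism (H' i)) ->
  laurent g ->
  pow_act H (pow_act H' g) t
  = pow_act (fun m x => \sum_(i <- box m) H i (H' (m - i)%MM x)) g t.
Proof.
move=> hH hH' gL; have [B gB] := laurent_shift_bound t gL.
have S i : shift_bound B (mulmon i g) t.
  move=> l lB; rewrite mulmonD gB //; apply: contra lB; apply: lepm_trans; exact: lem_addr.
have E i : mulmon i (pow_act H' g) t = \sum_(l <- box B) H' l (mulmon (i + l)%MM g t).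
  rewrite pow_act_mulmon // (pow_act_box hH' (S i)); apply: eq_bigr => l _.
  by rewrite mulmonD addmC.
have F0 i l : ~~ (i + l <= B)%MM -> H i (H' l (mulmon (i + l)%MM g t)) = 0.
  by move=> /gB ->; rewrite !zmorph0.
rewrite (@pow_act_box _ _ _ hH B) => [|i iB]; last first.
  rewrite E big1 // => l _; rewrite gB ?zmorph0 //.
  apply: contra iB; apply: lepm_trans; exact: lem_addr.
rewrite [RHS](@pow_act_box _ _ _ _ B) // => [|i x y]; last first.
  by rewrite -sumrB; apply: eq_bigr => l _; rewrite hH' hH.
transitivity (\sum_(i <- box B) \sum_(l <- box B) H i (H' l (mulmon (i + l)%MM g t))).
  by apply: eq_bigr => i _; rewrite E zmorph_sum.
rewrite cauchy_box //; apply: eq_bigr => m _; apply: eq_big_seq => i.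
by rewrite mem_box => im; rewrite addmC submK.
Qed.

Lemma pow_act_map (M M' M'' : zmodType) (phi : M' -> M'')
    (H : 'X_{1..n} -> M -> M') (g : kdist n M) t :
  zmod_morphism phi -> (forall i, zmod_morphism (H i)) -> laurent g ->
  pow_act (fun i x => phi (H i x)) g t = phi (pow_act H g t).
Proof.
move=> hphi hH gL; have [B gB] := laurent_shift_bound t gL.
rewrite !(@pow_act_box _ _ _ _ B) ?zmorph_sum // => i x y; by rewrite hH hphi.
Qed.

Lemma eq_pow_act (M M' : zmodType) (H H' : 'X_{1..n} -> M -> M') (g : kdist n M) t :
  (forall i x, H i x = H' i x) -> pow_act H g t = pow_act H' g t.
Proof. by move=> E; apply: eq_fsbigr => i _; rewrite E. Qed.

Lemma pow_act_delta (M : zmodType) (g : kdist n M) t :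
  pow_act (fun i x => if i == 0%MM then x else 0) g t = g t.
Proof.
rewrite /pow_act (@fsumT_delta _ _ 0%MM) => [|i /negbTE -> //].
by rewrite eqxx mulmon0.
Qed.

End PowerSeriesAction.

(** * Signs, parity and homogeneous elements *)

Section Sign.
Implicit Types m : int.

Lemma signzD m m' : (-1 : int) ^ (m + m') = (-1) ^ m * (-1) ^ m'.
Proof. by rewrite exprzDr // unitrN1. Qed.

Lemma signz_sq m : (-1 : int) ^ m * (-1) ^ m = 1.
Proof. by rewrite expN1r -exprMn mulrN1 opprK expr1n. Qed.

Lemma signzN m : (-1 : int) ^ (- m) = (-1) ^ m.
Proof. by rewrite !expN1r abszN. Qed.

Lemma signzM_self m : (-1 : int) ^ (m * m) = (-1) ^ m.
Proof. by rewrite !expN1r abszM -signr_odd oddM andbb signr_odd. Qed.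

End Sign.

Section Graded.
Variables (R : comPzRingType) (V : gradedModule R) (N : int).
Implicit Types (u v : V) (phi : V -> V) (i j d : int).

Lemma fsumT_fset (M : nmodType) (A : set int) (F : int -> M) :
  finite_set A -> (forall i, ~ A i -> F i = 0) ->
  \sum_(i \in [set: int]%classic) F i = \sum_(i <- fset_set A) F i.
Proof.
move=> finA F0; rewrite -fsbig_finite //; apply/esym/fsbig_widen => // i [_].
exact: F0.
Qed.

Lemma gcomp_out v i : ~ [set i | gcomp V i v != 0]%classic i -> gcomp V i v = 0.
Proof. by move/negP; rewrite negbK => /eqP. Qed.

Lemma in_degreeMz i v (m : int) : in_degree i v -> in_degree i (v *~ m).
Proof. by rewrite /in_degree raddfMz => /= ->. Qed.

Lemma in_degree0 i : in_degree i (0 : V).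
Proof. exact: linear0. Qed.

Lemma gcomp_homog i j v : in_degree i v -> gcomp V j v = if j == i then v else 0.
Proof. by rewrite /in_degree => iv; rewrite -{1}iv gcompK iv. Qed.

(** Reduces statements additive in v to homogeneous v. *)
Lemma homog_ind (P : V -> Prop) :
  (forall u v, P u -> P v -> P (u + v)) ->
  (forall i v, in_degree i v -> P v) -> forall v, P v.
Proof.
move=> PD Ph v; rewrite [v]gcomp_sum (fsumT_fset (gcomp_finite v)); last exact: gcomp_out.
elim: (fset_set _ : seq int) => [|i r IH]; rewrite ?big_nil ?big_cons.
  exact/(Ph 0)/in_degree0.
by apply: PD => //; apply: (Ph i); rewrite /in_degree gcompK eqxx.
Qed.

(** The involution acting as (-1)^(jN) on V^j. *)
Definition parity v := \sum_(j \in [set: int]%classic) gcomp V j v *~ (-1) ^ (j * N).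

Lemma parity_fset v : parity v =
  \sum_(j <- fset_set [set i | gcomp V i v != 0]%classic) gcomp V j v *~ (-1) ^ (j * N).
Proof. by apply: (fsumT_fset (gcomp_finite v)) => i /gcomp_out ->; rewrite mul0rz. Qed.

Lemma parity_zmod : zmod_morphism parity.
Proof.
move=> u v; pose A := ([set i | gcomp V i u != 0] `|` [set i | gcomp V i v != 0])%classic.
have finA : finite_set A by rewrite finite_setU; split; exact: gcomp_finite.
have Au i : ~ A i -> gcomp V i u = 0 by move=> Ai; apply: gcomp_out => ?; apply: Ai; left.
have Av i : ~ A i -> gcomp V i v = 0 by move=> Ai; apply: gcomp_out => ?; apply: Ai; right.
rewrite /parity !(fsumT_fset finA) => [|i Ai|i Ai|i Ai].
- by rewrite -sumrB; apply: eq_bigr => i _; rewrite linearB mulrzBl.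
- by rewrite Av // mul0rz.
- by rewrite Au // mul0rz.
- by rewrite linearB /= Au // Av // subrr mul0rz.
Qed.

Lemma parity_homog i v : in_degree i v -> parity v = v *~ (-1) ^ (i * N).
Proof.
move=> iv; rewrite /parity -(@fsbig_widen _ _ 0 +%R [set i]%classic) ?fsbig_set1//.
  by rewrite (gcomp_homog _ iv) eqxx.
by move=> j [_ /= /eqP /negbTE ji]; rewrite (gcomp_homog _ iv) ji mul0rz.
Qed.

(** The sign (-1)^((j-i)N) factors as (-1)^(jN) (-1)^(iN), one factor for the
    target and one for the source.  In this form additivity of tw N phi in phi
    and in the vector is clear. *)
Lemma twE phi v : zmod_morphism phi -> tw N phi v = parity (phi (parity v)).
Proof.
move=> hphi; have hp := parity_zmod.
have inner i : \sum_(j \in [set: int]%classic)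
    gcomp V j (phi (gcomp V i v)) *~ (-1) ^ ((j - i) * N)
    = parity (phi (gcomp V i v *~ (-1) ^ (i * N))).
  rewrite zmorphMz // zmorphMz // /parity.
  have fin := gcomp_finite (phi (gcomp V i v)).
  rewrite !(fsumT_fset fin) => [|j /gcomp_out ->|j /gcomp_out ->]; rewrite ?mul0rz //.
  rewrite mulrz_suml; apply: eq_bigr => j _.
  by rewrite -mulrzA mulrBl signzD signzN.
rewrite /tw; under eq_fsbigr => i _ do rewrite inner.
rewrite (fsumT_fset (gcomp_finite v)) => [|i /gcomp_out ->].
  by rewrite [parity v]parity_fset zmorph_sum // zmorph_sum.
by rewrite mul0rz !zmorph0.
Qed.

Lemma tw_zmod phi : zmod_morphism phi -> zmod_morphism (tw N phi).
Proof. by move=> hphi u v; rewrite !twE // parity_zmod hphi parity_zmod. Qed.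

Lemma tw_homog d phi v : zmod_morphism phi -> has_degree d phi ->
  tw N phi v = phi v *~ (-1) ^ (d * N).
Proof.
move=> hphi dphi; move: v; apply: homog_ind => [u v Eu Ev|i v iv].
  by rewrite (zmorphD (tw_zmod hphi)) Eu Ev zmorphD // mulrzDl.
rewrite twE // (parity_homog iv) zmorphMz // (zmorphMz parity_zmod).
rewrite (parity_homog (dphi _ _ iv)) -mulrzA mulrDl signzD mulrAC signz_sq mul1r //.
Qed.

Lemma past_homog n d phi (s : symb n) v : zmod_morphism phi -> has_degree d phi ->
  past N s phi v = phi v *~ (if s is Om _ then (-1) ^ (d * N) else 1).
Proof. by move=> hphi dphi; case: s => k /=; [|exact: tw_homog]. Qed.

Lemma past_zmod n (s : symb n) phi : zmod_morphism phi -> zmod_morphism (past N s phi).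
Proof. by case: s => k //=; exact: tw_zmod. Qed.

Lemma past_addl n (s : symb n) phi psi v : zmod_morphism phi -> zmod_morphism psi ->
  past N s (fun x => phi x + psi x) v = past N s phi v + past N s psi v.
Proof.
move=> hphi hpsi; case: s => k //=; rewrite !twE ?(zmorphD parity_zmod) //.
by move=> x y; rewrite hphi hpsi opprD addrACA.
Qed.

End Graded.

(** * Operations on series in one variable *)

Section OneVariable.
Variable n : nat.
Implicit Types (i j k m : 'X_{1..n}) (s t : symb n).

Lemma hasse_map (M M' : zmodType) (phi : M -> M') i (F : kdist n M) s :
  zmod_morphism phi -> hasse i (fun s' => phi (F s')) s = phi (hasse i F s).
Proof.
move=> hphi; case: s => k /=; first by rewrite !pmulrn zmorphMz.
by case: ifP => _; rewrite ?zmorphMz ?zmorph0.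
Qed.

Lemma hasseD (M : zmodType) i (F G : kdist n M) s :
  hasse i (fun s' => F s' + G s') s = hasse i F s + hasse i G s.
Proof.
by case: s => k /=; [rewrite mulrnDl | case: ifP; rewrite ?mulrzDl ?addr0].
Qed.

Lemma hasseB (M : zmodType) i (F G : kdist n M) s :
  hasse i (fun s' => F s' - G s') s = hasse i F s - hasse i G s.
Proof.
rewrite hasseD; congr (_ + _).
by apply: (hasse_map (phi := -%R)) => x y; rewrite opprD.
Qed.

Lemma eval_zmod (T : Type) (M : zmodType) (x : T) :
  zmod_morphism (fun f : T -> M => f x).
Proof. by []. Qed.

Definition neg_sign (N : int) t : int :=
  match t with
  | Pow k => (-1) ^+ mdeg k
  | Om k => (-1) ^ ((mdeg k)%:Z + N + 1)
  end.

Lemma knegE (N : int) (M : zmodType) (F : kdist n M) t :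
  kneg N F t = F t *~ neg_sign N t.
Proof. by case: t. Qed.

Lemma laurent_kneg (N : int) (M : zmodType) (F : kdist n M) :
  laurent F -> laurent (kneg N F).
Proof. by move=> [K FK]; exists K => k kK /=; rewrite FK // mul0rz. Qed.

Lemma laurent_kconst (M : zmodType) (x : M) : laurent (@kconst n M x).
Proof. by exists 0%MM. Qed.

Lemma pow_act_kconst (M M' : zmodType) (H : 'X_{1..n} -> M -> M') x k :
  (forall i, zmod_morphism (H i)) -> pow_act H (kconst x) (Pow k) = H k x.
Proof.
move=> hH; rewrite /pow_act (@fsumT_delta _ _ k) => [|i ik] /=.
  by rewrite lepm_refl -{1}[k in (k - _)%MM]add0m addmK eqxx.
case: ifP => ik'; last exact: zmorph0.
case: eqP => [k_i|_]; last exact: zmorph0.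
by move/eqP: ik; rewrite -(submK ik') k_i add0m.
Qed.

Lemma pow_act_signs (M M' : zmodType) (H : 'X_{1..n} -> M -> M') (g : kdist n M) e e' t :
  (forall i, zmod_morphism (H i)) -> laurent g ->
  pow_act H (fun t' => g t' *~ (if t' is Om _ then e else e')) t
  = pow_act H g t *~ (if t is Om _ then e else e').
Proof.
move=> hH gL; rewrite -pow_actMz //; apply: eq_fsbigr => i _; congr (H i _).
by case: t.
Qed.

Lemma signr_box k i : (i <= k)%MM ->
  (-1) ^+ mdeg k = (-1) ^+ mdeg i * (-1) ^+ mdeg (k - i) :> int.
Proof. by move=> ik; rewrite -exprD -mdegD addmC submK. Qed.

Lemma signr_sq (d : nat) : (-1) ^+ d * (-1) ^+ d = 1 :> int.
Proof. by rewrite -exprMn mulrN1 opprK expr1n. Qed.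

End OneVariable.

(** * Translation covariance *)

Section VertexAlgebra.
Variables (R : comPzRingType) (n : nat) (N : int) (V : gradedModule R).
Variable A : cva n N V.
Implicit Types (i j k m : 'X_{1..n}) (s t : symb n) (a b c v x : V) (p q r : int).

Local Notation Y := (cvaY A).
Local Notation T := (cvaT A).
Local Notation vac := (cvac A).

Definition Tneg i v : V := T i v *~ (-1) ^+ mdeg i.

Lemma T_zmod i : zmod_morphism (T i). Proof. by move=> x y; rewrite linearB. Qed.

Lemma Tneg_zmod i : zmod_morphism (Tneg i).
Proof. by move=> x y; rewrite /Tneg linearB mulrzBl. Qed.

Lemma Y_zmod a s : zmod_morphism (Y a s).
Proof. by move=> x y; rewrite linearB. Qed.

Lemma Y_zmodl s v : zmod_morphism (fun a => Y a s v).
Proof.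
move=> x y; have := cvaY_linear A s v (-1) y x.
by rewrite !scaleN1r ![- _ + _]addrC.
Qed.

Definition symb_deg s : int := if s is Om _ then N else 0.

Lemma Y_degree p a s : in_degree p a -> has_degree (p - symb_deg s) (Y a s).
Proof.
case: s => k pa /=; [rewrite subr0; exact: cvaY_Pow_degree | exact: cvaY_Om_degree].
Qed.

(** The coefficients of the powers of w in Y(a,z-w). *)
Definition shiftY i a s v := hasse i (fun s' => Y a s' v) s *~ (-1) ^+ mdeg i.

Lemma hasse_Y i a s v :
  hasse i (@endo R V \o Y a) s v = hasse i (fun s' => Y a s' v) s.
Proof. exact/esym/(hasse_map _ _ _ (@eval_zmod V V v)). Qed.

Lemma shiftY_zmod i a s : zmod_morphism (shiftY i a s).
Proof.
move=> x y; rewrite /shiftY -mulrzBl -hasseB; congr (hasse _ _ _ *~ _).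
by apply/funext => s'; rewrite Y_zmod.
Qed.

Lemma shiftY_addl i a a' s v : shiftY i (a + a') s v = shiftY i a s v + shiftY i a' s v.
Proof.
rewrite /shiftY -mulrzDl -hasseD; congr (hasse _ _ _ *~ _).
by apply/funext => s'; rewrite (zmorphD (Y_zmodl s' v)).
Qed.

Lemma shiftY_degree p i a s :
  in_degree p a -> has_degree (p - symb_deg s) (shiftY i a s).
Proof.
move=> pa d v dv; apply: in_degreeMz; case: s => k /=.
  by rewrite pmulrn; apply: in_degreeMz; exact: (Y_degree (Pow _) pa).
case: ifP => _; last exact: in_degree0.
by apply: in_degreeMz; exact: (Y_degree (Om (k - i)%MM) pa).
Qed.

Lemma past_T s i v : past N s (T i) v = T i v.
Proof.
by rewrite (past_homog _ _ _ (T_zmod i) (cvaT_degree A i)) mul0r expr0z; case: s.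
Qed.

Lemma hasse_translation a k s v :
  hasse k (fun s' => Y a s' v) s
  = \sum_(i <- box k) T i (Y a s (T (k - i)%MM v)) *~ (-1) ^+ mdeg (k - i).
Proof.
rewrite -hasse_Y; have := cva_translation A a v s (Pow k); rewrite /= => <-.
rewrite /kact_w_zw /kact /kmul fsum_box; apply: eq_bigr => i _.
by rewrite past_T /kact_z_w /= /endo (zmorphMz (Y_zmod a s)) (zmorphMz (T_zmod i)).
Qed.

Lemma shiftY_translation a k s v :
  shiftY k a s v = \sum_(i <- box k) Tneg i (Y a s (T (k - i)%MM v)).
Proof.
rewrite /shiftY hasse_translation mulrz_suml; apply: eq_big_seq => i.
rewrite mem_box => ik; rewrite -mulrzA (signr_box ik) mulrCA signr_sq mulr1 //.
Qed.

Lemma Y_vac s v : Y vac s v = kconst v s. Proof. exact: cva_vacuum. Qed.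

(** As Y(|0>,z) = id, translation covariance for a = |0> says that e^{w.T} and
    e^{-w.T} are inverse to each other; this is its left-hand side. *)
Lemma hasse_vac k v :
  hasse k (fun s' => Y vac s' v) (Pow 0%MM) = if k == 0%MM then v else 0.
Proof. by rewrite /= Y_vac add0m mbinn mulr1n. Qed.

Lemma Tneg_T k v :
  \sum_(i <- box k) Tneg i (T (k - i)%MM v) = if k == 0%MM then v else 0.
Proof.
have := shiftY_translation vac k (Pow 0%MM) v; rewrite /shiftY hasse_vac.
under eq_bigr => i _ do rewrite Y_vac /= eqxx.
by move=> <-; case: eqP => [->|_]; rewrite ?mul0rz // mdeg0.
Qed.

Lemma T_Tneg k v :
  \sum_(i <- box k) T i (Tneg (k - i)%MM v) = if k == 0%MM then v else 0.
Proof.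
have := hasse_translation vac k (Pow 0%MM) v; rewrite hasse_vac => ->.
by apply: eq_bigr => i _; rewrite Y_vac /= eqxx (zmorphMz (T_zmod i)).
Qed.

Lemma pow_act_Tneg_T (g : kdist n V) t : laurent g -> pow_act Tneg (pow_act T g) t = g t.
Proof.
move=> gL; rewrite pow_act_comp //; [|exact: Tneg_zmod|exact: T_zmod].
by rewrite -[RHS]pow_act_delta; apply: eq_pow_act => i x; rewrite Tneg_T.
Qed.

Lemma pow_act_T_Tneg (g : kdist n V) t : laurent g -> pow_act T (pow_act Tneg g) t = g t.
Proof.
move=> gL; rewrite pow_act_comp //; [|exact: T_zmod|exact: Tneg_zmod].
by rewrite -[RHS]pow_act_delta; apply: eq_pow_act => i x; rewrite T_Tneg.
Qed.

(** Translation covariance at -w, as the identity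
    Y(a,z-w) = e^{-w.T} Y(a,z) e^{w.T} of operators on laurent series. *)
Lemma pow_act_shiftY a s (g : kdist n V) t : laurent g ->
  pow_act (fun i => shiftY i a s) g t = pow_act Tneg (fun t' => Y a s (pow_act T g t')) t.
Proof.
move=> gL.
have -> : (fun t' => Y a s (pow_act T g t')) = pow_act (fun i x => Y a s (T i x)) g.
  by apply/funext => u; rewrite pow_act_map //; [exact: Y_zmod | exact: T_zmod].
rewrite pow_act_comp //; [|exact: Tneg_zmod|by move=> i x y; rewrite T_zmod Y_zmod].
by apply: eq_pow_act => i x; rewrite shiftY_translation.
Qed.

(** Multiply pow_act_shiftY by e^{w.T} on the left and apply both sides to a
    constant series. *)
Lemma Y_T a s k v :
  Y a s (T k v) = \sum_(i <- box k) T i (shiftY (k - i)%MM a s v).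
Proof.
have TL := laurent_pow_act T_zmod (laurent_kconst n v).
have YTL : laurent (fun t' => Y a s (pow_act T (kconst v) t')).
  by apply: (laurent_map _ TL); rewrite linear0.
have <- : pow_act T (pow_act (fun i => shiftY i a s) (kconst v)) (Pow k)
   = \sum_(i <- box k) T i (shiftY (k - i)%MM a s v).
  rewrite pow_act_comp; [|exact: T_zmod|by move=> i; exact: shiftY_zmod|exact: laurent_kconst].
  rewrite pow_act_kconst // => i x y.
  by rewrite -sumrB; apply: eq_bigr => j _; rewrite shiftY_zmod T_zmod.
have -> : pow_act (fun i => shiftY i a s) (kconst v)
  = pow_act Tneg (fun t' => Y a s (pow_act T (kconst v) t')).
  by apply/funext => u; rewrite pow_act_shiftY //; exact: laurent_kconst.
by rewrite pow_act_T_Tneg // pow_act_kconst //; exact: T_zmod.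
Qed.

End VertexAlgebra.

(** * Skew symmetry *)

Section Skew.
Variables (R : comPzRingType) (n : nat) (N : int) (V : gradedModule R).
Variable A : cva n N V.
Implicit Types (i j k m : 'X_{1..n}) (s t : symb n) (a b c v x : V) (p q r : int).

Local Notation Y := (cvaY A).
Local Notation T := (cvaT A).
Local Notation vac := (cvac A).
Local Notation Tneg := (Tneg A).
Local Notation bracket p q a b :=
  (kbracket N p q (@endo R V \o Y a) (@endo R V \o Y b)).

Lemma tw_Y0 a t : tw N (Y a t) 0 = 0.
Proof. exact: (zmorph0 (tw_zmod N (Y_zmod A a t))). Qed.

Lemma bracket_vac_Pow_Pow p q a b m k :
  bracket p q a b (Pow m) (Pow k) vac
  = Y a (Pow m) (T k b) - Y b (Pow k) (T m a) *~ (-1) ^ (p * q).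
Proof. by rewrite /kbracket /kact_z_w /kact_w_z /= /endo !cva_creation. Qed.

Lemma bracket_vac_Pow_Om p q a b m k :
  bracket p q a b (Pow m) (Om k) vac = - (Y b (Om k) (T m a) *~ (-1) ^ (p * q)).
Proof.
rewrite /kbracket /kact_z_w /kact_w_z /= /endo !cva_creation /=.
by rewrite tw_Y0 sub0r.
Qed.

Lemma bracket_vac_Om p q a b m t :
  bracket p q a b (Om m) t vac = Y a (Om m) (kexp (fun k => T k b) t).
Proof.
rewrite /kbracket /kact_z_w /kact_w_z /= /endo !cva_creation /= tw_Y0.
case: t => k /=; first by rewrite mul0rz subr0.
by rewrite tw_Y0 !mul0rz subr0 linear0.
Qed.

(** The Omega_z-part of [Y(a,z), Y(b,w)]|0> is that of e^{w.T} Y(a,z-w) b, and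
    expanding the derivatives of Y(a,z) shows that this is the Omega_z-part of
    sum_j d_w^(j)Delta e^{w.T} a_(j)b. *)
Lemma om_expansion_bracket_vac p q a b K :
  (forall j, ~~ (j <= K)%MM -> Y a (Om j) b = 0) ->
  om_expansion K (fun j => kexp (fun k => T k (Y a (Om j) b))) 0%MM
    (fun s t => bracket p q a b s t vac).
Proof.
move=> aK m t; rewrite bracket_vac_Om.
case: t => k /=; last by rewrite linear0 big1 // => i _; rewrite mul0rz.
pose F j :=
  (if (m - j <= k)%MM then T (k - (m - j))%MM (Y a (Om j) b) else 0) *~ (mbin m j)%:Z.
transitivity (\sum_(j <- box K) F j); last first.
  apply: eq_big => [i|i _]; first by apply/esym/mnm_lepP => x; rewrite mnm0E.
  by rewrite subm0.
(* Terms vanish outside box K by assumption, and outside box m because of the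
   binomial coefficient. *)
have -> : \sum_(j <- box K) F j = \sum_(j <- box m) F j.
  rewrite -(@box_shrink _ _ K _ F (lem_addl m K)) => [|i _ /aK aK0]; last first.
    by rewrite /F aK0 linear0 if_same mul0rz.
  rewrite (@box_shrink _ _ m _ F (lem_addr m K)) // => i _ im.
  by rewrite /F mbin_small // mulr0z.
rewrite Y_T box_rev [RHS]box_rev.
(* Both sides become sums over l = m - j with l <= k and l <= m. *)
pose G l := T (k - l)%MM (Y a (Om (m - l)%MM) b) *~ (mbin m l)%:Z.
transitivity (\sum_(l <- box k | (l <= m)%MM) G l).
  rewrite [RHS]big_mkcond /=; apply: eq_big_seq => l; rewrite mem_box => lk.
  rewrite submBA // addmC addmK /shiftY /=; case: ifP => lm; last by rewrite mul0rz linear0.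
  by rewrite -mulrzA mulrAC signr_sq mul1r (zmorphMz (T_zmod A _)).
rewrite box_swap [LHS]big_mkcond /=; apply: eq_big_seq => l; rewrite mem_box => lm.
rewrite /F submBA // addmC addmK mbin_sub //.
by case: ifP => // _; rewrite mul0rz.
Qed.

(** The Omega_z-part of the commutator on the vacuum determines the coefficients
    of its local expansion, and that expansion determines the rest of the
    commutator.  The coefficient of z^0 is the one that contains Y(b,w)a. *)
Lemma skew_symmetry p q a b t : in_degree p a -> in_degree q b ->
  pow_act T (kneg N (fun t' => Y a t' b)) t = Y b t a *~ (-1) ^ (p * q).
Proof.
move=> pa qb; have [K0 bK0] := cva_locality A pa qb.
have [L abL] := cva_field A a b.
(* Large enough for the local expansion, for the a_(j)b and, when t is Om k, to
   contain k. *)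
pose w := if t is Om k then k else 0%MM.
pose K := (K0 + L + w)%MM.
have locK : local_upto N K (fun s t => bracket p q a b s t vac).
  apply: (local_upto_map (@eval_zmod V V vac)); apply: local_upto_le bK0.
  by rewrite /K -addmA lem_addr.
have aK j : ~~ (j <= K)%MM -> Y a (Om j) b = 0.
  move=> jK; apply: abL; apply: contra jK => /lepm_trans; apply.
  by rewrite /K -addmA [(L + w)%MM]addmC addmA lem_addl.
have E := om_expansion_bracket_vac p q aK.
have : bracket p q a b (Pow 0%MM) t vac = \sum_(j <- box K)
    delta_term N j (kexp (fun k => T k (Y a (Om j) b))) (Pow 0%MM) t.
  move/local_uptoE: locK => ->; apply: eq_big_seq => j; rewrite mem_box => jK.
  by congr (delta_term _ _ _ _ _); apply/funext => u; rewrite (resz_mul_zw _ _ E) jK.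
case: t @w @K {locK} aK {E} => k w K aK.
  rewrite bracket_vac_Pow_Pow cvaT0 big1 => [|j _]; last by rewrite /= mul0rz.
  move=> /eqP; rewrite subr_eq0 => /eqP <-.
  rewrite (@pow_act_box _ _ _ _ (T_zmod A) k) => [|i /negbTE /= -> //].
  rewrite Y_T; apply: eq_big_seq => i; rewrite mem_box => ik.
  by rewrite /= ik /shiftY /= add0m mbinn mulr1n.
rewrite bracket_vac_Pow_Om cvaT0 => /eqP; rewrite eqr_oppLR => /eqP ->.
rewrite (@pow_act_box _ _ _ _ (T_zmod A) K) => [|i iK]; last first.
  rewrite /= aK ?mul0rz //; apply: contra iK; apply: lepm_trans; exact: lem_addl.
have kK : (k <= K)%MM by exact: lem_addl.
rewrite (@box_shrink _ _ (K - k)%MM _ _ (lem_subr _ _)) => [|i iK iKk]; last first.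
  rewrite /= aK ?mul0rz ?linear0 //; apply: contra iKk => /mnm_lepP H.
  by apply/mnm_lepP => x; move: (H x); rewrite mnmBE mnmDE; lia.
rewrite -(box_translate _ kK) big_mkcond -sumrN /=; apply: eq_bigr => j _.
rewrite add0m mbinn; case: ifPn => kj; last by rewrite mul0rz oppr0.
rewrite [(k + _)%MM]addmC submK // (zmorphMz (T_zmod A _)) -mulrNz; congr (_ *~ _).
by rewrite mulr1 signzD signzD mulrN1 -exprnP mulrC.
Qed.

Lemma skew_symmetry_neg p q a b t : in_degree p a -> in_degree q b ->
  kneg N (fun t' => Y a t' b) t
  = pow_act Tneg (fun t' => Y b t' a) t *~ (-1) ^ (p * q).
Proof.
move=> pa qb; have L := laurent_kneg N (cva_field A a b).
rewrite -pow_actMz; [|exact: Tneg_zmod|exact: cva_field].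
have <- : pow_act T (kneg N (fun t' => Y a t' b))
    = fun t' => Y b t' a *~ (-1) ^ (p * q).
  apply/funext => u; exact: skew_symmetry.
exact/esym/pow_act_Tneg_T.
Qed.

Lemma shift_bound_past B s i (phi : V -> V) (g : kdist n V) t :
  zmod_morphism phi -> shift_bound B g t -> ~~ (i <= B)%MM ->
  past N s phi (mulmon i g t) = 0.
Proof. by move=> hphi gB iB; rewrite gB // (zmorph0 (past_zmod N s hphi)). Qed.

(** * The associator *)

Lemma cva_prod_sum a b c s t :
  cva_prod A a b c s t = \sum_(i \in [set: 'X_{1..n}]%classic)
    past N t (shiftY A i a s) (mulmon i (kneg N (fun t' => Y b t' c)) t).
Proof.
have E i : kshiftN (@endo R V \o Y a) s (Pow i) = shiftY A i a s.
  apply/funext => x; rewrite /= /shiftY -hasse_Y.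
  exact: (zmorphMz (@eval_zmod V V x)).
rewrite /cva_prod /kact_zw_w /kact /kmul; case: t => k; last first.
  rewrite [X in _ + X]fsbig1 ?addr0 //; apply: eq_fsbigr => i _.
  by rewrite E.
rewrite fsum_box (@fsumT_box _ _ k) => [|i /negbTE ik]; last first.
  by rewrite /= ik (zmorph0 (@shiftY_zmod _ _ _ _ A i a s)).
by apply: eq_big_seq => i; rewrite mem_box => ik; rewrite E /= ik.
Qed.

Lemma cva_prod_box B a b c s t :
  shift_bound B (kneg N (fun t' => Y b t' c)) t ->
  cva_prod A a b c s t = \sum_(i <- box B)
    past N t (shiftY A i a s) (mulmon i (kneg N (fun t' => Y b t' c)) t).
Proof.
move=> gB; rewrite cva_prod_sum (@fsumT_box _ _ B) // => i.
exact: shift_bound_past (@shiftY_zmod _ _ _ _ A i a s) gB.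
Qed.


Lemma cva_iterD a b b' c s t :
  cva_iter A a (b + b') c s t = cva_iter A a b c s t + cva_iter A a b' c s t.
Proof.
by rewrite /cva_iter !knegE -mulrzDl (zmorphD (Y_zmod A a s)) (zmorphD (Y_zmodl A t c)).
Qed.

Lemma cva_iterDl a a' b c s t :
  cva_iter A (a + a') b c s t = cva_iter A a b c s t + cva_iter A a' b c s t.
Proof.
by rewrite /cva_iter !knegE -mulrzDl (zmorphD (Y_zmodl A s b)) (zmorphD (Y_zmodl A t c)).
Qed.

Lemma cva_iterDr a b c c' s t :
  cva_iter A a b (c + c') s t = cva_iter A a b c s t + cva_iter A a b c' s t.
Proof. by rewrite /cva_iter !knegE -mulrzDl (zmorphD (Y_zmod A _ t)). Qed.

Lemma cva_prodDl a a' b c s t :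
  cva_prod A (a + a') b c s t = cva_prod A a b c s t + cva_prod A a' b c s t.
Proof.
have [B gB] := laurent_shift_bound t (laurent_kneg N (cva_field A b c)).
rewrite !(@cva_prod_box B) // -big_split; apply: eq_bigr => i _ /=.
rewrite -past_addl; [|exact: (@shiftY_zmod _ _ _ _ A)|exact: (@shiftY_zmod _ _ _ _ A)].
by congr (past N t _ _); apply/funext => x; exact: shiftY_addl.
Qed.

(** Additivity in b and in c at once: only the series Y(b,w)c matters. *)
Lemma cva_prod_addr a b b' b'' c c' c'' s t :
  (forall t, Y b'' t c'' = Y b t c + Y b' t c') ->
  cva_prod A a b'' c'' s t = cva_prod A a b c s t + cva_prod A a b' c' s t.
Proof.
move=> E.
have [B gB] := laurent_shift_bound t (laurent_kneg N (cva_field A b c)).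
have [B' gB'] := laurent_shift_bound t (laurent_kneg N (cva_field A b' c')).
have {}gB := shift_bound_le (lem_addr B B') gB.
have {}gB' := shift_bound_le (lem_addl B B') gB'.
have Ei i : mulmon i (kneg N (fun t' => Y b'' t' c'')) t
  = mulmon i (kneg N (fun t' => Y b t' c)) t + mulmon i (kneg N (fun t' => Y b' t' c')) t.
  by case: t {gB gB'} => k /=; rewrite !E mulrzDl //; case: ifP; rewrite ?addr0.
rewrite !(@cva_prod_box (B + B')%MM) //; last first.
  by move=> i iB; rewrite Ei gB // gB' // addr0.
rewrite -big_split; apply: eq_bigr => i _ /=; rewrite Ei.
exact: (zmorphD (past_zmod N t (@shiftY_zmod _ _ _ _ A i a s))).
Qed.

Lemma cva_prodDm a b b' c s t :
  cva_prod A a (b + b') c s t = cva_prod A a b c s t + cva_prod A a b' c s t.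
Proof. by apply: cva_prod_addr => u; rewrite (zmorphD (Y_zmodl A u c)). Qed.

Lemma cva_prodDr a b c c' s t :
  cva_prod A a b (c + c') s t = cva_prod A a b c s t + cva_prod A a b c' s t.
Proof. by apply: cva_prod_addr => u; rewrite (zmorphD (Y_zmod A b u)). Qed.

(** Skew symmetry rewrites Y(b,-w)c, and e^{-w.T} is then moved to the left of
    Y(a,z-w), where it turns that operator into Y(a,z). *)
Lemma cva_prod_homog p q r a b c s t :
  in_degree p a -> in_degree q c -> in_degree r b ->
  cva_prod A a b c s t
  = pow_act Tneg (fun t' => past N t' (Y a s) (Y c t' b)) t *~ (-1) ^ (r * q).
Proof.
move=> pa qc rb; set d := p - symb_deg N s.
have shiftY_zm i := @shiftY_zmod _ _ _ _ A i a s.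
pose g := kneg N (fun t' => Y b t' c); pose h t' := Y c t' b.
have hL : laurent h := cva_field A c b.
have gL : laurent g := laurent_kneg N (cva_field A b c).
have gE : g = fun t' => pow_act Tneg h t' *~ (-1) ^ (r * q).
  by apply/funext => u; exact: skew_symmetry_neg.
have TL : laurent (pow_act Tneg h) by apply: laurent_pow_act => //; exact: Tneg_zmod.
have YhL : laurent (fun t' => Y a s (h t')) by apply: laurent_map => //; exact: linear0.
pose e : int := if t is Om _ then (-1) ^ (d * N) else 1.
have -> : cva_prod A a b c s t = pow_act (fun i => shiftY A i a s) g t *~ e.
  rewrite cva_prod_sum -pow_actMz //; apply: eq_fsbigr => i _.
  rewrite (past_homog _ _ _ (shiftY_zm i) (@shiftY_degree _ _ _ _ A p i a s pa)).
  rewrite -(zmorphMz (shiftY_zm i)).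
  by congr (shiftY _ _ _ _ _); rewrite (mulmon_map (phi := fun x => x *~ e)) ?mul0rz.
have -> : pow_act (fun i => shiftY A i a s) g t
    = pow_act Tneg (fun t' => Y a s (h t')) t *~ (-1) ^ (r * q).
  rewrite gE pow_actMz // pow_act_shiftY //.
  by have -> : pow_act T (pow_act Tneg h) = h by apply/funext => u; rewrite pow_act_T_Tneg.
rewrite -mulrzA mulrC mulrzA; congr (_ *~ _).
rewrite /e -pow_act_signs //; last exact: Tneg_zmod.
have -> // : (fun t' => past N t' (Y a s) (Y c t' b)) = fun t' =>
    Y a s (h t') *~ (if t' is Om _ then (-1) ^ (d * N) else 1).
by apply/funext => u; rewrite (past_homog _ _ _ (Y_zmod A a s) (Y_degree A s pa)).
Qed.

(** Skew symmetry for a_s b, of degree p + r or p + r - N, and c. *)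
Lemma cva_iter_homog p q r a b c s t :
  in_degree p a -> in_degree q c -> in_degree r b ->
  cva_iter A a b c s t
  = pow_act Tneg (fun t' => Y c t' (Y a s b)) t *~ (-1) ^ ((r + (p - symb_deg N s)) * q).
Proof.
move=> pa qc rb; apply: skew_symmetry_neg => //.
exact: (Y_degree A s pa).
Qed.

(** Both kinds of sign in the second term, the commutator sign and the ones for
    moving Y(c,w) past Omega_z, combine into one that does not depend on
    t.  It is the sign produced by skew symmetry in cva_iter_homog. *)
Lemma bracket_homog p q a c b s t : in_degree p a -> in_degree q c ->
  bracket p q a c s t b = past N t (Y a s) (Y c t b)
    - Y c t (Y a s b) *~ (-1) ^ ((p - symb_deg N s) * q).
Proof.
move=> pa qc; rewrite /kbracket /kact_z_w; congr (_ - _); rewrite /kact_w_z.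
rewrite (past_homog _ _ _ (Y_zmod A c t) (Y_degree A t qc)).
case: s => m /=; first by rewrite subr0 mulr1z; case: t.
case: t => k /=; rewrite -!mulrzA; congr (_ *~ _).
  by rewrite subr0 mulrBl signzD signzN mulrC [N * q]mulrC.
rewrite !mulrBl !signzD !signzN signzM_self [q * N]mulrC.
rewrite -mulrA [(-1) ^ N * (_ * _)]mulrA signz_sq mul1r; exact: mulrC.
Qed.

Lemma laurent_bracket p q a c b s : in_degree p a -> in_degree q c ->
  laurent (fun t => bracket p q a c s t b).
Proof.
move=> pa qc; have [K cK] := cva_field A c b; have [L cL] := cva_field A c (Y a s b).
exists (K + L)%MM => k kKL; rewrite bracket_homog // cK ?cL /= ?mul0rz ?subr0 ?tw_Y0 //;
  apply: contra kKL => /lepm_trans; apply; [exact: lem_addl | exact: lem_addr].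
Qed.

Lemma weak_associator_homog p q r a b c s t :
  in_degree p a -> in_degree q c -> in_degree r b ->
  cva_prod A a b c s t - cva_iter A a b c s t
  = pow_act Tneg (fun t' => bracket p q a c s t' b) t *~ (-1) ^ (r * q).
Proof.
move=> pa qc rb; rewrite (cva_prod_homog s t pa qc rb) (cva_iter_homog s t pa qc rb).
set d := p - symb_deg N s.
have cL : laurent (fun t' => Y c t' (Y a s b)) := cva_field A c (Y a s b).
have acL : laurent (fun t' => past N t' (Y a s) (Y c t' b)).
  by have [K cK] := cva_field A c b; exists K => k kK; rewrite cK //= tw_Y0.
have -> : (fun t' => bracket p q a c s t' b) = fun t' =>
    past N t' (Y a s) (Y c t' b) + Y c t' (Y a s b) *~ - (-1) ^ (d * q).
  by apply/funext => u; rewrite (bracket_homog _ _ _ pa qc) mulrNz.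
rewrite pow_actD //; [|exact: Tneg_zmod|]; last first.
  by apply: (laurent_map (phi := fun x => x *~ _)) => //; rewrite mul0rz.
rewrite pow_actMz //; last exact: Tneg_zmod.
rewrite mulrzDl -mulrzA mulNr mulrNz mulrDl signzD.
by rewrite [_ ^ (r * q) * _]mulrC.
Qed.


Lemma local_weak_associator_homog p q a c K : in_degree p a -> in_degree q c ->
  local_upto N K (bracket p q a c) ->
  forall b, local_upto N K (fun s t => cva_prod A a b c s t - cva_iter A a b c s t).
Proof.
move=> pa qc locK; apply: (@homog_ind _ V) => [b b' locb locb'|r b rb].
  have -> : (fun s t => cva_prod A a (b + b') c s t - cva_iter A a (b + b') c s t)
    = fun s t => (cva_prod A a b c s t - cva_iter A a b c s t)
      + (cva_prod A a b' c s t - cva_iter A a b' c s t).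
    apply/funext => s; apply/funext => t.
    by rewrite addrACA -opprD -cva_iterD cva_prodDm.
  exact: local_uptoD.
have -> : (fun s t => cva_prod A a b c s t - cva_iter A a b c s t)
  = fun s t => pow_act Tneg (fun t' => bracket p q a c s t' b) t *~ (-1) ^ (r * q).
  by apply/funext => s; apply/funext => t; exact: weak_associator_homog.
apply: (local_upto_map (phi := fun x => x *~ _)) => [x y|]; first exact: mulrzBl.
apply: (local_upto_pow_act (f := fun s t => bracket p q a c s t b)).
- exact: Tneg_zmod.
- by move=> s; exact: laurent_bracket.
- exact: (local_upto_map (@eval_zmod V V b)).
Qed.

End Skew.

Theorem proposition3p2p7 (R : comPzRingType) (n : nat) (hn : (1 <= n)%N)
    (N : int) (V : gradedModule R) (A : cva n N V) (a c : V) :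
  exists K : 'X_{1..n}, forall b : V,
    local_upto N K
      (fun s t => cva_prod A a b c s t - cva_iter A a b c s t)%R.
Proof.
have sumK (K K' : 'X_{1..n}) (f g h : V -> kdist2 n V) :
    (forall b s t, h b s t = f b s t + g b s t) ->
    (forall b, local_upto N K (f b)) -> (forall b, local_upto N K' (g b)) ->
    exists K, forall b, local_upto N K (h b).
  move=> hE fK gK; exists (K + K')%MM => b.
  have -> : h b = fun s t => f b s t + g b s t by apply/funext => s; apply/funext => t.
  by apply: local_uptoD; [apply: local_upto_le (fK b) | apply: local_upto_le (gK b)];
     rewrite ?lem_addr ?lem_addl.
move: a c; apply: (@homog_ind _ V) => [a a' aK aK' c|p a pa].
  have [K aKc] := aK c; have [K' aKc'] := aK' c.
  apply: sumK aKc aKc' => b s t; rewrite cva_prodDl cva_iterDl opprD; exact: addrACA.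
apply: (@homog_ind _ V) => [c c' [K cK] [K' cK']|q c qc].
  apply: sumK cK cK' => b s t; rewrite cva_prodDr cva_iterDr opprD; exact: addrACA.
have [K locK] := cva_locality A pa qc.
by exists K; exact: local_weak_associator_homog pa qc locK.
Qed.
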